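(* Let $k=\mathbb{C}$, let $A=k[\Gamma]$ be a monomial curve, and let $D=\mathrm{Diff}(A)$ be its $\mathbb{Z}$-graded ring of $k$-linear differential operators. Let $J^*=\{\alpha\in k: 0\le \mathrm{Re}(\alpha)<1,\ \alpha\neq 0\}$. Then the simple graded left $D$-modules, up to graded isomorphisms and twists, are given by $$\{M_0\}\cup\{M_\alpha:\alpha\in J^*\}\cup\{M_\infty\},$$ that is, each of these modules is a simple graded left $D$-module, and every simple graded left $D$-module is isomorphic, as a graded module, to a twist of exactly one of them. Moreover, $M_0\cong A$, and $M_\alpha\cong D/D\cdot(E-\alpha)$ for all $\alpha\in J^*$.
   Context: Let $k=\mathbb{C}$ and $\mathbb{N}_0=\{0,1,2,\dots\}$. A numerical semigroup is a submonoid $\Gamma\subseteq\mathbb{N}_0$ with $\mathbb{N}_0\setminus\Gamma$ finite; its semigroup algebra $A=k[\Gamma]=\bigoplus_{n\in\Gamma}k\,t^n\subseteq k[t]$ is called a monomial curve. Put $B=k[t]$, $T=k[t,t^{-1}]$ and $\partial=d/dt$. Then $\mathrm{Diff}(T)=k[t,t^{-1}]\langle\partial\rangle$ is the ring of $k$-linear differential operators on $T$, graded by letting $t^n\partial^m$ have degree $n-m$. The ring $D=\mathrm{Diff}(A)$ of $k$-linear differential operators on $A$ is identified with the graded subring $\{P\in\mathrm{Diff}(T):P(A)\subseteq A\}$ of $\mathrm{Diff}(T)$. The Euler derivation is $E=t\partial\in D$, of degree $0$. The ring $\mathrm{Diff}(B)=A_1(k)=k\langle t,\partial\rangle$ is the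 first Weyl algebra. Graded left modules are $\mathbb{Z}$-graded; graded morphisms are homogeneous of degree zero. For a graded module $M$ and an integer $n$, the twist $M[n]$ is the same module with grading $M[n]_i=M_{n+i}$. A simple graded left module is a simple object in the category of graded left modules (equivalently, for $D$ and for $\mathrm{Diff}(T)$, a graded module which is simple as an ungraded module). Let $S=\{t^n:n\in\Gamma\}$, so that $S^{-1}A=T$ and $S^{-1}D=\mathrm{Diff}(T)$. Let $N_\alpha=\mathrm{Diff}(T)/\mathrm{Diff}(T)\cdot(E-\alpha)$ for $\alpha\in k$, with the class of $1$ in degree $0$. For $\alpha\in J^*\cup\{0\}$, $M_\alpha$ denotes the simple graded left $D$-module, unique up to graded isomorphism, such that $S^{-1}M_\alpha\cong N_\alpha$ as graded modules. Let $D(B,A)=\{P\in\mathrm{Diff}(T):P(B)\subseteq A\}$, a graded $D$-$A_1(k)$ bimodule; then $M_\infty=D(B,A)\otimes_{A_1(k)}\big(A_1(k)/A_1(k)\cdot t\big)$. The module $A$ is a graded left $D$-module with $t^n$ in degree $n$, and $D/D\cdot(E-\alpha)$ is graded with the class of $1$ in degree $0$. *)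

(* Defs.v *)
From HB Require Import structures.
From mathcomp Require Import all_boot all_order all_algebra.
From mathcomp Require Import boolp classical_sets functions cardinality reals.
From mathcomp Require Import complex zify.

Set Implicit Arguments.
Unset Strict Implicit.
Unset Printing Implicit Defensive.

Import Order.TTheory GRing.Theory Num.Theory.

Local Open Scope classical_set_scope.
Local Open Scope ring_scope.
Local Open Scope complex_scope.
Local Open Scope quotient_scope.

(* A ring (resp. a left module) together with a family of subsets, its        *)
(* homogeneous pieces.  The axioms of a graded module are the predicate       *)
(* [is_graded_module] below, not part of the record.                          *)
Record grRing := GrRing {
  gr_ring :> nzRingType;
  gr_hom : int -> set gr_ring }.

Record grMod (L : grRing) := GrMod {
  gm_mod :> lmodType L;
  gm_hom : int -> set gm_mod }.

Definition internal_direct_sum (V : zmodType) (h : int -> set V) : Prop :=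
  [/\ forall i, h i 0 /\ (forall x y, h i x -> h i y -> h i (x - y)),
      forall x, exists (s : seq int) (c : int -> V),
        [/\ uniq s, forall i, h i (c i) & x = \sum_(i <- s) c i]
    & forall (s : seq int) (c : int -> V), uniq s -> (forall i, h i (c i)) ->
        \sum_(i <- s) c i = 0 -> forall i, i \in s -> c i = 0].

Section GradedModules.
Variable L : grRing.
Implicit Types M N : grMod L.

Definition is_graded_module M : Prop :=
  internal_direct_sum (@gm_hom L M) /\
  (forall i j (r : L) (x : M),
     gr_hom i r -> gm_hom j x -> gm_hom (i + j) (r *: x)).

Definition is_submodule M (N : set M) : Prop :=
  [/\ N 0, forall x y, N x -> N y -> N (x + y)
    & forall (r : L) x, N x -> N (r *: x)].

Definition is_graded_submodule M (N : set M) : Prop :=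
  is_submodule N /\
  (forall x, N x -> exists (s : seq int) (c : int -> M),
     [/\ uniq s, forall i, gm_hom i (c i) /\ N (c i)
       & x = \sum_(i <- s) c i]).

Definition simple_graded M : Prop :=
  [/\ is_graded_module M, exists x : M, x <> 0
    & forall N : set M, is_graded_submodule N -> N = [set 0] \/ N = setT].

Definition gr_iso M N : Prop :=
  exists f : {linear M -> N},
    bijective f /\ (forall i (x : M), gm_hom i x <-> gm_hom i (f x)).

Definition twist (n : int) M : grMod L :=
  @GrMod L (gm_mod M) (fun i => @gm_hom L M (n + i)).

End GradedModules.

Section Cyclic.
Variables (L : nzRingType) (a : L).

Definition lideal : {pred L} := [pred x | `[< exists b, x = b * a >]].

Fact lideal_zmod : zmod_closed lideal.
Proof.
split=> [|x y]; rewrite !inE; first by exists 0; rewrite mul0r.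
move=> [b ->] [c ->]; exists (b - c).
by rewrite mulrBl.
Qed.
HB.instance Definition _ := GRing.isZmodClosed.Build L lideal lideal_zmod.

Definition cyclic_mod : Type := Quotient.quot lideal.
HB.instance Definition _ := GRing.Zmodule.on cyclic_mod.

Definition cyclic_pi (x : L) : cyclic_mod := \pi_(Quotient.quot lideal) x.

Definition cyclic_scale (r : L) (x : cyclic_mod) : cyclic_mod :=
  cyclic_pi (r * repr (x : Quotient.quot lideal)).

Fact cyclic_piP x y :
  reflect (exists b, x - y = b * a) (cyclic_pi x == cyclic_pi y).
Proof.
by apply: (iffP idP); rewrite -Quotient.idealrBE inE.
Qed.

Fact cyclic_pi_surj x : exists y, x = cyclic_pi y.
Proof. by exists (repr (x : Quotient.quot lideal)); rewrite /cyclic_pi reprK. Qed.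

Fact cyclic_scaleE r x : cyclic_scale r (cyclic_pi x) = cyclic_pi (r * x).
Proof.
apply/eqP/cyclic_piP; rewrite -mulrBr.
have /cyclic_piP[b ->] :
    cyclic_pi (repr (cyclic_pi x : Quotient.quot lideal)) == cyclic_pi x.
  by rewrite /cyclic_pi reprK.
by exists (r * b); rewrite mulrA.
Qed.

Fact cyclic_piD : {morph cyclic_pi : x y / x + y}.
Proof. by move=> x y; rewrite /cyclic_pi Quotient.pi_add. Qed.

Fact cyclic_scaleA r s x :
  cyclic_scale r (cyclic_scale s x) = cyclic_scale (r * s) x.
Proof. by have [y ->] := cyclic_pi_surj x; rewrite !cyclic_scaleE mulrA. Qed.

Fact cyclic_scale1 : left_id 1 cyclic_scale.
Proof.
by move=> x; have [y ->] := cyclic_pi_surj x; rewrite cyclic_scaleE mul1r.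
Qed.

Fact cyclic_scaleDr : right_distributive cyclic_scale +%R.
Proof.
move=> r x y; have [x' ->] := cyclic_pi_surj x.
have [y' ->] := cyclic_pi_surj y.
by rewrite -cyclic_piD !cyclic_scaleE mulrDr cyclic_piD.
Qed.

Fact cyclic_scaleDl x : {morph cyclic_scale^~ x : r s / r + s}.
Proof.
move=> r s; have [y ->] := cyclic_pi_surj x.
by rewrite !cyclic_scaleE mulrDl cyclic_piD.
Qed.

HB.instance Definition _ := GRing.Zmodule_isLmodule.Build L cyclic_mod
  cyclic_scaleA cyclic_scale1 cyclic_scaleDr cyclic_scaleDl.

End Cyclic.

(* Graded with the class of 1 in degree 0; meaningful for homogeneous [a].    *)
Definition gr_cyclic (L : grRing) (a : L) : grMod L :=
  @GrMod L (cyclic_mod a)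
    (fun i => [set x | exists2 r : L, gr_hom i r & x = cyclic_pi a r]).

Record bimodule (L Q : nzRingType) := Bimodule {
  bm_mod :> lmodType L;
  ract : bm_mod -> Q -> bm_mod;
  ractDl : forall p p' q, ract (p + p') q = ract p q + ract p' q;
  ractDr : forall p q q', ract p (q + q') = ract p q + ract p q';
  ractA : forall p q q', ract (ract p q) q' = ract p (q * q');
  ract1 : forall p, ract p 1 = p;
  ractZ : forall r p q, ract (r *: p) q = r *: ract p q }.

Section Tensor.
Variables (L Q : nzRingType) (P : bimodule L Q) (M : lmodType Q).

Definition balanced (G : zmodType) (b : P -> M -> G) : Prop :=
  [/\ forall p p' m, b (p + p') m = b p m + b p' m,
      forall p m m', b p (m + m') = b p m + b p m'
    & forall p q m, b (ract p q) m = b p (q *: m)].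

Definition tensor_eval (G : zmodType) (b : P -> M -> G) (u : seq (P * M)) : G :=
  \sum_(x <- u) b x.1 x.2.

(* P \otimes_Q M is built from formal sums of pure tensors; two of them are    *)
(* identified if and only if no balanced map separates them, which yields the *)
(* usual universal property (lemmas tens_balanced, tensor_span and            *)
(* tensor_universal).                                                         *)
Definition tensor_eq (u v : seq (P * M)) : bool :=
  `[< forall (G : zmodType) (b : P -> M -> G), balanced b ->
        tensor_eval b u = tensor_eval b v >].

Fact tensor_eq_equiv : equiv_class_of tensor_eq.
Proof.
split=> [u|u v|v u w].
- exact/asboolP.
- by apply/asboolP/asboolP => h G b hb; rewrite (h G b hb).
- by move=> /asboolP h /asboolP h'; apply/asboolP => G b hb; rewrite h ?h'.
Qed.
Canonical tensor_eq_equiv_rel := EquivRelPack tensor_eq_equiv.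
Canonical tensor_eq_enc := defaultEncModRel tensor_eq.

Definition tensor : Type := {eq_quot tensor_eq}.
HB.instance Definition _ := Choice.on tensor.

Definition tensor_pi (u : seq (P * M)) : tensor := \pi_{eq_quot tensor_eq} u.
Definition tensor_repr (x : tensor) : seq (P * M) :=
  repr (x : {eq_quot tensor_eq}).

Definition tens (p : P) (m : M) : tensor := tensor_pi [:: (p, m)].

Fact tensor_piP u v :
  tensor_pi u = tensor_pi v <->
  forall (G : zmodType) (b : P -> M -> G), balanced b ->
    tensor_eval b u = tensor_eval b v.
Proof. by split=> [/eqmodP/asboolP|h]; last exact/eqmodP/asboolP. Qed.

Fact tensor_reprK x : tensor_pi (tensor_repr x) = x.
Proof. by rewrite /tensor_pi /tensor_repr reprK. Qed.

Fact tensor_eval_repr (G : zmodType) (b : P -> M -> G) u : balanced b ->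
  tensor_eval b (tensor_repr (tensor_pi u)) = tensor_eval b u.
Proof. by move=> hb; have /tensor_piP := tensor_reprK (tensor_pi u); apply. Qed.

Fact tensor_eval_cat (G : zmodType) (b : P -> M -> G) u v :
  tensor_eval b (u ++ v) = tensor_eval b u + tensor_eval b v.
Proof. by rewrite /tensor_eval big_cat. Qed.

Definition tensor_map (f : P -> P) (u : seq (P * M)) :=
  [seq (f x.1, x.2) | x <- u].

Fact tensor_eval_map (G : zmodType) (b : P -> M -> G) f u :
  tensor_eval b (tensor_map f u) = tensor_eval (fun p => b (f p)) u.
Proof. by rewrite /tensor_eval big_map. Qed.

Definition tensor_add (x y : tensor) : tensor :=
  tensor_pi (tensor_repr x ++ tensor_repr y).
Definition tensor_opp (x : tensor) : tensor :=
  tensor_pi (tensor_map -%R (tensor_repr x)).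
Definition tensor_scale (r : L) (x : tensor) : tensor :=
  tensor_pi (tensor_map ( *:%R r) (tensor_repr x)).

Fact balancedZ (G : zmodType) (b : P -> M -> G) r :
  balanced b -> balanced (fun p => b (r *: p)).
Proof.
case=> bDl bDr bQ; split=> [p p' m|p m m'|p q m]; first by rewrite scalerDr bDl.
  by rewrite bDr.
by rewrite -ractZ bQ.
Qed.

Fact tensor_addA : associative tensor_add.
Proof.
move=> x y z; apply/tensor_piP => G b hb.
by rewrite !(tensor_eval_cat, tensor_eval_repr) // addrA.
Qed.

Fact tensor_addC : commutative tensor_add.
Proof.
by move=> x y; apply/tensor_piP => G b hb; rewrite !tensor_eval_cat addrC.
Qed.

Fact tensor_add0 : left_id (tensor_pi [::]) tensor_add.
Proof.
move=> x; rewrite -[RHS]tensor_reprK; apply/tensor_piP => G b hb.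
by rewrite tensor_eval_cat tensor_eval_repr // /tensor_eval big_nil add0r.
Qed.

Fact tensor_addN : left_inverse (tensor_pi [::]) tensor_opp tensor_add.
Proof.
move=> x; apply/tensor_piP => G b hb.
rewrite tensor_eval_cat tensor_eval_repr // tensor_eval_map.
rewrite /tensor_eval -big_split big_nil big1 //= => i _.
have [bDl _ _] := hb; rewrite -bDl addNr.
by apply: (addrI (b 0 i.2)); rewrite -bDl !addr0.
Qed.

HB.instance Definition _ := GRing.isZmodule.Build tensor
  tensor_addA tensor_addC tensor_add0 tensor_addN.

Fact tensor_scaleA r s x :
  tensor_scale r (tensor_scale s x) = tensor_scale (r * s) x.
Proof.
apply/tensor_piP => G b hb.
rewrite !tensor_eval_map tensor_eval_repr; last exact: balancedZ.
rewrite tensor_eval_map /tensor_eval; apply: eq_bigr => i _.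
by rewrite scalerA.
Qed.

Fact tensor_scale1 : left_id 1 tensor_scale.
Proof.
move=> x; rewrite -[RHS]tensor_reprK; apply/tensor_piP => G b hb.
by rewrite tensor_eval_map; apply: eq_bigr => i _; rewrite scale1r.
Qed.

Fact tensor_scaleDr : right_distributive tensor_scale +%R.
Proof.
move=> r x y; apply/tensor_piP => G b hb.
rewrite tensor_eval_map tensor_eval_repr; last exact: balancedZ.
by rewrite !(tensor_eval_cat, tensor_eval_repr) // !tensor_eval_map.
Qed.

Fact tensor_scaleDl x : {morph tensor_scale^~ x : r s / r + s}.
Proof.
move=> r s; apply/tensor_piP => G b hb.
rewrite !(tensor_eval_cat, tensor_eval_repr) // !tensor_eval_map.
rewrite /tensor_eval -big_split; apply: eq_bigr => i _ /=.
by have [bDl _ _] := hb; rewrite scalerDl bDl.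
Qed.

HB.instance Definition _ := GRing.Zmodule_isLmodule.Build L tensor
  tensor_scaleA tensor_scale1 tensor_scaleDr tensor_scaleDl.

Lemma tens_balanced : balanced tens.
Proof.
split=> *; apply/tensor_piP => G b [bDl bDr bQ];
  rewrite ?(tensor_eval_cat, tensor_eval_repr) //;
  by rewrite /tensor_eval !big_seq1 /=.
Qed.

Lemma tensZ r p m : r *: tens p m = tens (r *: p) m.
Proof.
apply/tensor_piP => G b hb.
rewrite tensor_eval_map tensor_eval_repr; last exact: balancedZ.
by rewrite /tensor_eval !big_seq1.
Qed.

Lemma tensor_span (x : tensor) :
  exists u : seq (P * M), x = \sum_(y <- u) tens y.1 y.2.
Proof.
exists (tensor_repr x); rewrite -[LHS]tensor_reprK.
elim: (tensor_repr x) => [|y u IHu]; first by rewrite big_nil.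
rewrite big_cons -IHu; apply/tensor_piP => G b hb.
rewrite tensor_eval_cat !tensor_eval_repr // -tensor_eval_cat.
by case: y.
Qed.

Lemma tensor_universal (G : zmodType) (b : P -> M -> G) : balanced b ->
  exists f : tensor -> G,
    {morph f : x y / x + y} /\ (forall p m, f (tens p m) = b p m).
Proof.
move=> hb; exists (fun x => tensor_eval b (tensor_repr x)); split=> [x y|p m].
  by rewrite tensor_eval_repr // tensor_eval_cat.
by rewrite tensor_eval_repr // /tensor_eval big_seq1.
Qed.

End Tensor.

Record grBimod (L Q : grRing) := GrBimod {
  gb_bimod :> bimodule L Q;
  gb_hom : int -> set gb_bimod }.

(* Degree i: finite sums of p \otimes m with p, m homogeneous and             *)
(* deg p + deg m = i.                                                         *)
Definition gr_tensor (L Q : grRing) (P : grBimod L Q) (M : grMod Q) : grMod L :=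
  @GrMod L (tensor P M)
    (fun i => [set x | exists u : seq (P * M),
       (forall y, y \in u ->
          exists j l, [/\ gb_hom j y.1, gm_hom l y.2 & j + l = i])
       /\ x = \sum_(y <- u) tens y.1 y.2]).

Section LaurentPolynomials.
Variable R : realType.
Local Notation k := R[i].

(* T = k[t, t^-1]: the Laurent polynomial \sum_i f_i t^i is represented by    *)
(* its coefficient function f.                                                *)
Definition finsupp : {pred int -> k} :=
  [pred f | `[< exists n : nat, forall i : int, (n < absz i)%N -> f i = 0 >]].

Fact finsupp_closed : submod_closed finsupp.
Proof.
split=> [|c f g]; rewrite !inE; first by exists 0%N.
move=> [n hn] [m hm]; exists (maxn n m) => i.
rewrite gtn_max => /andP[hi hi'].
have -> : (c *: f + g) i = c * f i + g i by [].
by rewrite hn // hm // mulr0 addr0.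
Qed.
HB.instance Definition _ := GRing.isSubmodClosed.Build k (int -> k) finsupp
  (GRing.submod_closed_semi finsupp_closed).

Record laurent := Laurent { coefT :> int -> k; _ : coefT \in finsupp }.
HB.instance Definition _ := [isSub for coefT].
HB.instance Definition _ := [Choice of laurent by <:].
HB.instance Definition _ := [SubChoice_isSubLmodule of laurent by <:].

Lemma coefT_inj : injective coefT. Proof. exact: val_inj. Qed.

Definition linear_pred : {pred laurent -> laurent} := [pred P | `[< linear P >]].

Fact linear_pred_closed : submod_closed linear_pred.
Proof.
split=> [|c P Q]; rewrite !inE.
  move=> a u v.
  by rewrite -[LHS]/(0 : laurent) -[RHS]/(a *: (0 : laurent) + 0) scaler0 addr0.
move=> hP hQ a u v.
rewrite -[LHS]/(c *: P (a *: u + v) + Q (a *: u + v)) hP hQ.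
rewrite -[RHS]/(a *: (c *: P u + Q u) + (c *: P v + Q v)).
by rewrite !scalerDr !scalerA [c * a]mulrC addrACA.
Qed.
HB.instance Definition _ :=
  GRing.isSubmodClosed.Build k (laurent -> laurent) linear_pred
    (GRing.submod_closed_semi linear_pred_closed).

Record endT := EndT { endT_fun :> laurent -> laurent;
                      _ : endT_fun \in linear_pred }.
HB.instance Definition _ := [isSub for endT_fun].
HB.instance Definition _ := [Choice of endT by <:].
HB.instance Definition _ := [SubChoice_isSubLmodule of endT by <:].

Lemma endT_linear (P : endT) : linear P.
Proof. by case: P => P /= /asboolP. Qed.

Lemma endT_eq (P Q : endT) : P =1 Q -> P = Q.
Proof. by move=> h; apply/val_inj/funext. Qed.

Lemma endTD (P Q : endT) f : (P + Q) f = P f + Q f.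
Proof. by []. Qed.

Lemma endTZ c (P : endT) f : (c *: P) f = c *: P f.
Proof. by []. Qed.

Definition mk_endT (P : laurent -> laurent) (hP : linear P) : endT :=
  @EndT P (asboolT hP : P \in linear_pred).

Fact id_linear : linear (@id laurent). Proof. by []. Qed.
Definition one_endT : endT := mk_endT id_linear.

Fact comp_linear (P Q : endT) : linear (P \o Q).
Proof. by move=> a u v /=; rewrite !endT_linear. Qed.
Definition mul_endT (P Q : endT) : endT := mk_endT (comp_linear P Q).

Fact mul_endTA : associative mul_endT.
Proof. by move=> P Q S; apply: endT_eq. Qed.
Fact mul_endT1l : left_id one_endT mul_endT.
Proof. by move=> P; apply: endT_eq. Qed.
Fact mul_endT1r : right_id one_endT mul_endT.
Proof. by move=> P; apply: endT_eq. Qed.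
Fact mul_endTDl : left_distributive mul_endT +%R.
Proof. by move=> P Q S; apply: endT_eq. Qed.
Fact mul_endTDr : right_distributive mul_endT +%R.
Proof.
move=> P Q S; apply: endT_eq => f.
rewrite -[LHS]/(P (Q f + S f)) -[RHS]/(P (Q f) + P (S f)).
by rewrite -{1}[Q f]scale1r endT_linear scale1r.
Qed.

Fact monomT_subproof (n : int) : (fun i => (i == n)%:R : k) \in finsupp.
Proof.
rewrite inE; exists (absz n) => i hi.
by case: eqP hi => // ->; rewrite ltnn.
Qed.
Definition monomT (n : int) : laurent := Laurent (monomT_subproof n).

Fact one_endT_neq0 : one_endT != 0.
Proof.
apply/eqP => /(congr1 (fun P : endT => coefT (P (monomT 0)) 0)).
rewrite -[LHS]/((0 == 0 :> int)%:R : k) -[RHS]/(0 : k) eqxx.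
by move/eqP; rewrite oner_eq0.
Qed.

HB.instance Definition _ := GRing.Zmodule_isNzRing.Build endT
  mul_endTA mul_endT1l mul_endT1r mul_endTDl mul_endTDr one_endT_neq0.

Lemma endTM (P Q : endT) f : (P * Q) f = P (Q f). Proof. by []. Qed.
Lemma endT1 f : (1 : endT) f = f. Proof. by []. Qed.

Fact endT_scaleAl (c : k) (P Q : endT) : c *: (P * Q) = (c *: P) * Q.
Proof. exact: endT_eq. Qed.
HB.instance Definition _ := GRing.Lmodule_isLalgebra.Build k endT endT_scaleAl.

Lemma endT0r (P : endT) : P 0 = 0.
Proof. by have := endT_linear P (-1) 0 0; rewrite scaler0 addr0 scaleN1r addNr. Qed.

Fact endT_scaleAr (c : k) (P Q : endT) : c *: (P * Q) = P * (c *: Q).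
Proof.
apply: endT_eq => f; rewrite endTM endTZ endTM endTZ.
by rewrite -[c *: Q f]addr0 endT_linear endT0r addr0.
Qed.
HB.instance Definition _ := GRing.Lalgebra_isAlgebra.Build k endT endT_scaleAr.

(* Multiplication by t^n, for an integer n.                                   *)
Fact shiftT_subproof (n : int) (f : laurent) :
  (fun i : int => f (i - n)) \in finsupp.
Proof.
case: f => f /=; rewrite !inE => -[m hm].
exists (m + absz n)%N => i hi; apply: hm; lia.
Qed.
Definition shiftT (n : int) (f : laurent) : laurent :=
  Laurent (shiftT_subproof n f).
Fact shiftT_linear n : linear (shiftT n).
Proof. by move=> a f g; apply: coefT_inj; apply: funext. Qed.
Definition tpow (n : int) : endT := mk_endT (shiftT_linear n).

Fact derivT_subproof (f : laurent) :
  (fun i : int => (i + 1)%:~R * f (i + 1)) \in finsupp.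
Proof.
case: f => f /=; rewrite !inE => -[m hm].
exists m.+1 => i hi; rewrite hm ?mulr0 //; lia.
Qed.
Definition derivT (f : laurent) : laurent := Laurent (derivT_subproof f).
Fact derivT_linear : linear derivT.
Proof.
move=> a f g; apply: coefT_inj; apply: funext => i /=.
rewrite -[LHS]/((i + 1)%:~R * (a * f (i + 1) + g (i + 1))).
rewrite -[RHS]/(a * ((i + 1)%:~R * f (i + 1)) + (i + 1)%:~R * g (i + 1)).
by rewrite mulrDr mulrCA.
Qed.
Definition dT : endT := mk_endT derivT_linear.

(* The homogeneous piece of degree d: the k-span of the operators             *)
(* t^n \partial^m with n - m = d.                                             *)
Definition homT (d : int) : set endT :=
  [set P | exists s : seq (k * int * nat),
     (forall x, x \in s -> x.1.2 - x.2%:Z = d) /\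
     P = \sum_(x <- s) x.1.1 *: (tpow x.1.2 * dT ^+ x.2)].

Record subalgebra := Subalgebra {
  sa_pred : {pred endT};
  sa_closed : subalg_closed sa_pred }.

HB.instance Definition _ (S : subalgebra) :=
  GRing.isSubalgClosed.Build k endT (sa_pred S)
    (GRing.subalg_closed_semi (sa_closed S)).

Record sa_type (S : subalgebra) := SaElt {
  sa_val :> endT;
  sa_valP : sa_val \in sa_pred S }.

HB.instance Definition _ S := [isSub for @sa_val S].
HB.instance Definition _ S := [Choice of sa_type S by <:].
HB.instance Definition _ S := [SubChoice_isSubAlgebra of sa_type S by <:].

Definition sa_gr (S : subalgebra) : grRing :=
  @GrRing (sa_type S) (fun d => [set P | homT d (sa_val P)]).

Inductive alg_gen (X : set endT) : endT -> Prop :=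
| AlgGen_base P : X P -> alg_gen X P
| AlgGen_one : alg_gen X 1
| AlgGen_lin (c : k) P Q :
    alg_gen X P -> alg_gen X Q -> alg_gen X (c *: P + Q)
| AlgGen_mul P Q : alg_gen X P -> alg_gen X Q -> alg_gen X (P * Q).

Fact alg_gen_closed X : subalg_closed [pred P | `[< alg_gen X P >]].
Proof.
split=> [|c P Q|P Q]; rewrite !inE; first exact: AlgGen_one.
  exact: AlgGen_lin.
exact: AlgGen_mul.
Qed.
Definition generated X : subalgebra := Subalgebra (alg_gen_closed X).

(* Diff(T) = k[t, t^-1]<\partial> and A_1(k) = k<t, \partial>; both act         *)
(* faithfully on T, and are taken as subalgebras of End_k(T).                 *)
Definition sDiffT := generated [set tpow 1; tpow (-1); dT].
Definition sWeyl := generated [set tpow 1; dT].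
Definition DiffT : grRing := sa_gr sDiffT.
Definition Weyl : grRing := sa_gr sWeyl.

Definition eulerT : endT := tpow 1 * dT.

Fact eulerT_DiffT : eulerT \in sa_pred sDiffT.
Proof.
by apply: rpredM; rewrite inE; apply: AlgGen_base; [left; left|right].
Qed.
Definition eulerDiffT : DiffT := SaElt eulerT_DiffT.

Fact tpow1_Weyl : tpow 1 \in sa_pred sWeyl.
Proof. by rewrite inE; apply: AlgGen_base; left. Qed.
Definition tWeyl : Weyl := SaElt tpow1_Weyl.

(* N_alpha = Diff(T) / Diff(T) (E - alpha).                                   *)
Definition Nmod (alpha : k) : grMod DiffT :=
  gr_cyclic (eulerDiffT - alpha *: (1 : sa_type sDiffT) : DiffT).

Record numerical_semigroup := NumericalSemigroup {
  ns_set :> set nat;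
  ns_zero : ns_set 0%N;
  ns_add : forall m n, ns_set m -> ns_set n -> ns_set (m + n)%N;
  ns_cofinite : finite_set (~` ns_set) }.

(* The k-span of the t^n with n in X, a set of natural numbers.               *)
Definition monspan (X : set nat) : {pred laurent} :=
  [pred f | `[< forall i : int, coefT f i <> 0 -> exists2 n, X n & i = n%:Z >]].

Fact monspan_closed X : submod_closed (monspan X).
Proof.
split=> [|c f g]; rewrite !inE; first by move=> i [].
move=> hf hg i.
have -> : coefT (c *: f + g) i = c * coefT f i + coefT g i by [].
move=> h; have [fi0|/hf//] := pselect (coefT f i = 0).
by apply: hg => gi0; apply: h; rewrite fi0 gi0 mulr0 addr0.
Qed.
HB.instance Definition _ X := GRing.isSubmodClosed.Build k laurent (monspan X)
  (GRing.submod_closed_semi (monspan_closed X)).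

(* B = k[t].                                                                  *)
Definition polyT : {pred laurent} := monspan setT.

Fact Weyl_DiffT (P : endT) : P \in sa_pred sWeyl -> P \in sa_pred sDiffT.
Proof.
rewrite !inE; elim=> {P} [P||c P Q _ hP _ hQ|P Q _ hP _ hQ].
- by move=> [->|->]; apply: AlgGen_base; [left; left|right].
- exact: AlgGen_one.
- exact: AlgGen_lin.
- exact: AlgGen_mul.
Qed.

Fact Weyl_polyT (P : endT) :
  P \in sa_pred sWeyl -> forall f, f \in polyT -> P f \in polyT.
Proof.
rewrite inE; elim=> {P} [P||c P Q _ hP _ hQ|P Q _ hP _ hQ] //.
- move=> + f; rewrite !inE => -[->|->] hf i /=.
    move=> /hf[n _ hn]; exists n.+1 => //; lia.
  move=> h; have [] := hf (i + 1); first by move=> h'; apply: h; rewrite h' mulr0.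
  case=> [|n] _ hn; last by exists n => //; lia.
  by case: h; rewrite hn mul0r.
- by move=> f hf; rewrite endTD endTZ rpredD ?rpredZ ?hP ?hQ.
- by move=> f hf; rewrite endTM hP ?hQ.
Qed.

Section MonomialCurve.
Variable Gamma : numerical_semigroup.

(* A = k[Gamma].                                                              *)
Definition curveT : {pred laurent} := monspan Gamma.

(* D = Diff(A) = {P in Diff(T) : P(A) \subseteq A}.                           *)
Definition sDiffA_pred : {pred endT} :=
  [pred P | (P \in sa_pred sDiffT) &&
            `[< forall f, f \in curveT -> P f \in curveT >]].

Fact sDiffA_predP P :
  reflect (P \in sa_pred sDiffT /\ forall f, f \in curveT -> P f \in curveT)
          (P \in sDiffA_pred).
Proof. by apply: (iffP andP) => -[hP /asboolP hPA]; split=> //; exact/asboolP. Qed.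

Fact sDiffA_closed : subalg_closed sDiffA_pred.
Proof.
split=> [|c P Q|P Q]; first by apply/sDiffA_predP; split; first exact: rpred1.
  move=> /sDiffA_predP[hP hPA] /sDiffA_predP[hQ hQA]; apply/sDiffA_predP.
  split=> [|f hf]; first by rewrite rpredD ?rpredZ.
  by rewrite endTD endTZ rpredD ?rpredZ ?hPA ?hQA.
move=> /sDiffA_predP[hP hPA] /sDiffA_predP[hQ hQA]; apply/sDiffA_predP.
split=> [|f hf]; first by rewrite rpredM.
by rewrite endTM hPA ?hQA.
Qed.
Definition sDiffA : subalgebra := Subalgebra sDiffA_closed.
Definition DiffA : grRing := sa_gr sDiffA.

Lemma DiffA_DiffT (P : DiffA) : sa_val P \in sa_pred sDiffT.
Proof. by case: P => P /= /sDiffA_predP[]. Qed.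

Lemma DiffA_curveT (P : DiffA) f : f \in curveT -> sa_val P f \in curveT.
Proof. by case: P => P /= /sDiffA_predP[_]; apply. Qed.

Fact eulerT_DiffA : eulerT \in sa_pred sDiffA.
Proof.
apply/sDiffA_predP; split=> [|f]; first exact: eulerT_DiffT.
rewrite !inE => hf i /= h.
apply: hf => fi0; apply: h.
rewrite -[LHS]/((i - 1 + 1)%:~R * coefT f (i - 1 + 1)) subrK fi0.
exact: mulr0.
Qed.
Definition eulerA : DiffA := SaElt eulerT_DiffA.

(* D / D (E - alpha).                                                         *)
Definition DmodE (alpha : k) : grMod DiffA :=
  gr_cyclic (eulerA - alpha *: (1 : sa_type sDiffA) : DiffA).

(* A as a graded left D-module, t^n being in degree n.                        *)
Record curve := Curve { curve_val : laurent; _ : curve_val \in curveT }.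
HB.instance Definition _ := [isSub for curve_val].
HB.instance Definition _ := [Choice of curve by <:].
HB.instance Definition _ := [SubChoice_isSubZmodule of curve by <:].

Definition curve_scale (P : DiffA) (f : curve) : curve :=
  Curve (DiffA_curveT P (valP f)).

Fact curve_scaleA P Q f :
  curve_scale P (curve_scale Q f) = curve_scale (P * Q) f.
Proof. exact: val_inj. Qed.
Fact curve_scale1 : left_id 1 curve_scale.
Proof. by move=> f; apply: val_inj. Qed.
Fact curve_scaleDr : right_distributive curve_scale +%R.
Proof.
move=> P f g; apply: val_inj => /=.
by rewrite -{1}[val f]scale1r endT_linear scale1r.
Qed.
Fact curve_scaleDl f : {morph curve_scale^~ f : P Q / P + Q}.
Proof. by move=> P Q; apply: val_inj. Qed.
HB.instance Definition _ := GRing.Zmodule_isLmodule.Build DiffA curve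
  curve_scaleA curve_scale1 curve_scaleDr curve_scaleDl.

Definition Acurve : grMod DiffA :=
  @GrMod DiffA curve
    (fun n => [set f | exists c : k, curve_val f = c *: monomT n]).

(* Diff(T) as a Diff(T)-D-bimodule.                                           *)
Definition inclA (P : DiffA) : DiffT := SaElt (DiffA_DiffT P).

Definition DiffT_bimod : bimodule DiffT DiffA.
Proof.
refine (@Bimodule DiffT DiffA (DiffT^o) (fun P Q => (P : DiffT) * inclA Q)
          _ _ _ _ _).
- by move=> P P' Q; exact: mulrDl.
- move=> P Q Q'; rewrite -[RHS]mulrDr; congr (_ * _); exact: val_inj.
- move=> P Q Q'; rewrite -[LHS]mulrA; congr (_ * _); exact: val_inj.
- by move=> P; rewrite -[RHS]mulr1; congr (_ * _); exact: val_inj.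
- by move=> S P Q; rewrite -[LHS]mulrA.
Defined.
Definition DiffT_grBimod : grBimod DiffT DiffA :=
  @GrBimod DiffT DiffA DiffT_bimod (@gr_hom DiffT).

(* S^-1 M = S^-1 D \otimes_D M, where S^-1 D = Diff(T).                       *)
Definition localize (M : grMod DiffA) : grMod DiffT :=
  gr_tensor DiffT_grBimod M.

(* D(B, A) = {P in Diff(T) : P(B) \subseteq A}, a D-A_1(k)-bimodule.          *)
Definition DBA_pred : {pred endT} :=
  [pred P | (P \in sa_pred sDiffT) &&
            `[< forall f, f \in polyT -> P f \in curveT >]].

Fact DBA_predP P :
  reflect (P \in sa_pred sDiffT /\ forall f, f \in polyT -> P f \in curveT)
          (P \in DBA_pred).
Proof. by apply: (iffP andP) => -[hP /asboolP hPA]; split=> //; exact/asboolP. Qed.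

Fact DBA_closed : submod_closed DBA_pred.
Proof.
split=> [|c P Q]; first by apply/DBA_predP; split=> [|f _]; exact: rpred0.
move=> /DBA_predP[hP hPA] /DBA_predP[hQ hQA]; apply/DBA_predP.
split=> [|f hf]; first by rewrite rpredD ?rpredZ.
by rewrite endTD endTZ rpredD ?rpredZ ?hPA ?hQA.
Qed.
HB.instance Definition _ := GRing.isSubmodClosed.Build k endT DBA_pred
  (GRing.submod_closed_semi DBA_closed).

Record DBA := MkDBA { DBA_val : endT; _ : DBA_val \in DBA_pred }.
HB.instance Definition _ := [isSub for DBA_val].
HB.instance Definition _ := [Choice of DBA by <:].
HB.instance Definition _ := [SubChoice_isSubZmodule of DBA by <:].

Fact DBA_lact_subproof (P : DiffA) (Q : DBA) :
  sa_val P * DBA_val Q \in DBA_pred.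
Proof.
case: Q => Q /= /DBA_predP[hQ hQA]; apply/DBA_predP.
split=> [|f hf]; first by rewrite rpredM ?DiffA_DiffT.
by rewrite endTM DiffA_curveT ?hQA.
Qed.
Definition DBA_lact (P : DiffA) (Q : DBA) : DBA := MkDBA (DBA_lact_subproof P Q).

Fact DBA_lactA P Q S : DBA_lact P (DBA_lact Q S) = DBA_lact (P * Q) S.
Proof. by apply: val_inj; exact: mulrA. Qed.
Fact DBA_lact1 : left_id 1 DBA_lact.
Proof. by move=> P; apply: val_inj; exact: mul1r. Qed.
Fact DBA_lactDr : right_distributive DBA_lact +%R.
Proof. by move=> P Q S; apply: val_inj; exact: mulrDr. Qed.
Fact DBA_lactDl S : {morph DBA_lact^~ S : P Q / P + Q}.
Proof. by move=> P Q; apply: val_inj; exact: mulrDl. Qed.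
HB.instance Definition _ := GRing.Zmodule_isLmodule.Build DiffA DBA
  DBA_lactA DBA_lact1 DBA_lactDr DBA_lactDl.

Fact DBA_ract_subproof (P : DBA) (Q : Weyl) : DBA_val P * sa_val Q \in DBA_pred.
Proof.
case: P => P /= /DBA_predP[hP hPA]; apply/DBA_predP.
split=> [|f hf]; first by rewrite rpredM //; exact/Weyl_DiffT/valP.
by rewrite endTM hPA // Weyl_polyT //; exact: valP.
Qed.
Definition DBA_ract (P : DBA) (Q : Weyl) : DBA := MkDBA (DBA_ract_subproof P Q).

Definition DBA_bimod : bimodule DiffA Weyl.
Proof.
refine (@Bimodule DiffA Weyl DBA DBA_ract _ _ _ _ _).
- by move=> P P' Q; apply: val_inj; exact: mulrDl.
- by move=> P Q Q'; apply: val_inj; exact: mulrDr.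
- by move=> P Q Q'; apply: val_inj; rewrite /= mulrA.
- by move=> P; apply: val_inj; exact: mulr1.
- by move=> S P Q; apply: val_inj; rewrite /= mulrA.
Defined.
Definition DBA_grBimod : grBimod DiffA Weyl :=
  @GrBimod DiffA Weyl DBA_bimod (fun d => [set P : DBA | homT d (DBA_val P)]).

(* M_infty = D(B, A) \otimes_{A_1(k)} A_1(k) / A_1(k) t.                      *)
Definition Minf : grMod DiffA := gr_tensor DBA_grBimod (gr_cyclic tWeyl).

Definition is_Malpha (alpha : k) (M : grMod DiffA) : Prop :=
  simple_graded M /\ gr_iso (localize M) (Nmod alpha).

End MonomialCurve.

Definition Jstar (alpha : k) : Prop :=
  0 <= complex.Re alpha < 1 /\ alpha <> 0.

End LaurentPolynomials.

(* The family {M_0} \cup {M_alpha : alpha in J^*} \cup {M_infty}, indexed by  *)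
(* [Some alpha] for alpha in J^* \cup {0} and by [None] for infinity.         *)
Section Family.
Variables (R : realType) (Gamma : numerical_semigroup).
Variable M : R[i] -> grMod (DiffA R Gamma).

Definition Mfam (i : option R[i]) : grMod (DiffA R Gamma) :=
  if i is Some alpha then M alpha else Minf R Gamma.

Definition Mfam_index (i : option R[i]) : Prop :=
  if i is Some alpha then Jstar alpha \/ alpha = 0 else True.

End Family.

(* Main.v *)
Require Import Defs.
From HB Require Import structures.
From mathcomp Require Import all_boot all_order all_algebra.
From mathcomp Require Import boolp classical_sets functions cardinality reals complex.
From mathcomp Require Import zify ring lra.

(** The Euler operator [E] governs everything. An operator of degree [d] on
    Laurent polynomials is [t^d p(E)] for a polynomial [p], and maps [t^n] to
    [p(n) t^(n + d)]; it belongs to [D] if and only if [p(n) = 0] whenever [n] is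
    in [Gamma] and [n + d] is not. In particular [D] is graded, with degree zero
    part [k[E]].

    Let [M] be a simple graded [D]-module. As [k] is algebraically closed, [E]
    has an eigenvector in some homogeneous piece of [M]
    ([simple_eigenvector]); its eigenvalue is called a weight of [M]. The weight
    increases by one with the degree, and the operators of degree zero act by scalars
    depending only on the weight. Therefore [M] is determined, up to graded
    isomorphism, by one weight together with its degree
    ([simple_iso_of_weight]), hence up to a twist by one weight.

    It remains to find the weights of a given [M]. One passes from a weight [w]
    to [w + d] and back unless every admissible [p] vanishes at [w], or
    symmetrically at [w + d] for [- d]; as [Gamma] is cofinite, an admissible
    [p] with [p(w) <> 0] exists unless [w] is in [Gamma] and [w + d] is not. So
    the weights of [M] form a class for the relation: [w - w'] is an integer, and
    [w] is in [Gamma] if and only if [w'] is ([simple_has_weight]). The classes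
    are the cosets [alpha + Z] for [alpha] in [J^*], the set [Gamma], and the
    complement of [Gamma] in the integers. They are realized by
    [D / D (E - alpha)], by [A], and by [M_infinity], which has weight [-1]
    because [E = \partial t - 1]. These three modules are simple, because
    homogeneous operators act transitively on their nonzero homogeneous
    elements.

    For the modules [M_alpha], localization preserves degrees and weights, so a
    simple module whose localization is [N_alpha] has weight [alpha] in degree
    zero as soon as degree zero is inhabited. The only alternative is that its
    weights are integers outside [Gamma]; but then large powers of [t] kill
    every homogeneous element and the localization is zero
    ([is_Malpha_vector]). Conversely the localization of a simple module that has
    a vector of weight [alpha] in degree zero is [N_alpha], provided that this
    vector survives in it ([localize_iso]). *)

Set Implicit Arguments.
Unset Strict Implicit.
Unset Printing Implicit Defensive.

Import Order.TTheory GRing.Theory Num.Theory.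
Local Open Scope classical_set_scope.
Local Open Scope ring_scope.
Local Open Scope complex_scope.

(** * Homogeneous differential operators *)

Section HomogeneousOperators.
Variable R : realType.
Local Notation k := R[i].
Local Notation endT := (endT R).
Local Notation E := (eulerT R).
Implicit Types (d e : int) (p q : {poly k}) (P Q : endT).

Definition op d p : endT := tpow R d * horner_alg E p.

Lemma coefTD (f g : laurent R) i : coefT (f + g) i = coefT f i + coefT g i.
Proof. by []. Qed.
Lemma coefTZ c (f : laurent R) i : coefT (c *: f) i = c * coefT f i.
Proof. by []. Qed.
Lemma coefT_sum I (s : seq I) (F : I -> laurent R) i :
  coefT (\sum_(x <- s) F x) i = \sum_(x <- s) coefT (F x) i.
Proof. by elim/big_rec2: _ => // x y f _ <-. Qed.
Lemma endT_sum I (s : seq I) (F : I -> endT) f :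
  (\sum_(x <- s) F x) f = \sum_(x <- s) F x f.
Proof. by elim/big_rec2: _ => // x y g _ <-. Qed.

Lemma laurentP (f g : laurent R) : (forall i, coefT f i = coefT g i) -> f = g.
Proof. by move=> h; apply/coefT_inj/funext. Qed.

Lemma coef_euler f i : coefT (E f) i = i%:~R * coefT f i.
Proof. by rewrite -[LHS]/((i - 1 + 1)%:~R * coefT f (i - 1 + 1)) subrK. Qed.

Lemma coef_horner_euler p f i :
  coefT (horner_alg E p f) i = p.[i%:~R] * coefT f i.
Proof.
elim/poly_ind: p f => [|p c IH] f; first by rewrite rmorph0 horner0 mul0r.
rewrite rmorphD rmorphM /= horner_algX horner_algC hornerMXaddC.
rewrite -[LHS]/(coefT (horner_alg E p (E f) + c *: f) i).
by rewrite coefTD IH coef_euler mulrDl mulrA.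
Qed.

Lemma coef_op d p f i :
  coefT (op d p f) i = p.[(i - d)%:~R] * coefT f (i - d).
Proof. by rewrite endTM -[LHS]/(coefT (horner_alg E p f) (i - d)) coef_horner_euler. Qed.

(** The commutation rule [p(E) t^e = t^e p(E + e)]. *)
Lemma op_mul d p e q :
  op d p * op e q = op (d + e) ((p \Po ('X + (e%:~R)%:P)) * q).
Proof.
apply: endT_eq => f; apply: laurentP => i; rewrite endTM !coef_op mulrA hornerM.
rewrite horner_comp !hornerE -intrD.
have -> : i - d - e = i - (d + e) by lia.
by have -> : i - (d + e) + e = i - d by lia.
Qed.

Lemma op_lin c d p q : op d (c *: p + q) = c *: op d p + op d q.
Proof.
apply: endT_eq => f; apply: laurentP => i.
by rewrite endTD endTZ coefTD coefTZ !coef_op hornerD hornerZ mulrDl mulrA.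
Qed.

Lemma op0 d : op d 0 = 0. Proof. by rewrite /op rmorph0 mulr0. Qed.
Lemma opD d p q : op d (p + q) = op d p + op d q.
Proof. by rewrite /op rmorphD mulrDr. Qed.
Lemma opZ c d p : op d (c *: p) = c *: op d p.
Proof. by rewrite -[c *: p]addr0 op_lin op0 addr0. Qed.
Lemma opB d p q : op d (p - q) = op d p - op d q.
Proof. by rewrite -scaleN1r opD opZ scaleN1r. Qed.

Lemma op_monom d p (n m : int) :
  coefT (op d p (monomT R n)) m = (m == n + d)%:R * p.[n%:~R].
Proof.
rewrite coef_op /= subr_eq mulrC; case: eqP => [->|]; last by rewrite !mul0r.
by rewrite addrK.
Qed.

Lemma poly_eq_on_nat p q : (forall n : nat, p.[n%:R] = q.[n%:R]) -> p = q.
Proof.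
move=> h; apply/eqP; rewrite -subr_eq0; apply/eqP.
apply: (@roots_geq_poly_eq0 _ _ [seq n%:R | n <- iota 0 (size (p - q))]).
- by apply/allP => _ /mapP[n _ ->]; rewrite rootE hornerD hornerN h subrr.
- by rewrite map_inj_uniq ?iota_uniq // => m n /eqP; rewrite eqr_nat => /eqP.
- by rewrite size_map size_iota.
Qed.

Lemma tpow_op d : tpow R d = op d 1.
Proof. by rewrite /op rmorph1 mulr1. Qed.
Lemma dT_op : dT R = op (-1) 'X.
Proof.
apply: endT_eq => f; apply: laurentP => i.
by rewrite coef_op hornerX opprK.
Qed.
Lemma euler_op : E = op 0 'X.
Proof.
apply: endT_eq => f; apply: laurentP => i.
by rewrite coef_op hornerX subr0 coef_euler.
Qed.
Lemma one_op : 1 = op 0 1.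
Proof.
by apply: endT_eq => f; apply: laurentP => i; rewrite coef_op hornerC mul1r subr0.
Qed.

Lemma homT0 d : homT d (0 : endT).
Proof. by exists [::]; rewrite big_nil. Qed.
Lemma homTD d P Q : homT d P -> homT d Q -> homT d (P + Q).
Proof.
move=> [s [hs ->]] [s' [hs' ->]]; exists (s ++ s'); rewrite big_cat.
by split=> // x; rewrite mem_cat => /orP[/hs|/hs'].
Qed.
Lemma homTZ d c P : homT d P -> homT d (c *: P).
Proof.
move=> [s [hs ->]]; exists [seq (c * x.1.1, x.1.2, x.2) | x <- s]; split.
  by move=> _ /mapP[x /hs hx ->].
by rewrite big_map scaler_sumr; apply: eq_bigr => x _; rewrite scalerA.
Qed.
Lemma homTB d P Q : homT d P -> homT d Q -> homT d (P - Q).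
Proof. by move=> hP hQ; rewrite -scaleN1r; apply/homTD/homTZ. Qed.

Lemma dTX_op n : exists p, dT R ^+ n = op (- n%:Z) p.
Proof.
elim: n => [|n [p hp]]; first by exists 1; rewrite expr0 one_op.
by rewrite exprS hp dT_op op_mul; eexists; congr op; lia.
Qed.

Lemma homT_base d (n : int) m : n - m%:Z = d -> homT d (tpow R n * dT R ^+ m).
Proof.
move=> h; exists [:: (1, n, m)]; rewrite big_seq1 scale1r; split=> // x.
by rewrite inE => /eqP->.
Qed.

(** Leibniz's rule [E t^n = t^n E + n t^n] makes the homogeneous pieces stable
    under left multiplication by the Euler operator, hence by every polynomial
    in it. *)
Lemma homT_euler d P : homT d P -> homT d (E * P).
Proof.
move=> [s [hs ->]]; rewrite mulr_sumr big_seq; apply: (big_ind (homT d)).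
- exact: homT0.
- exact: homTD.
move=> x /hs hx; rewrite -scalerAr; apply: homTZ.
have -> : E * (tpow R x.1.2 * dT R ^+ x.2) =
    tpow R (x.1.2 + 1) * dT R ^+ x.2.+1 +
    x.1.2%:~R *: (tpow R x.1.2 * dT R ^+ x.2).
  rewrite exprS !mulrA scalerAl -mulrDl; congr (_ * _).
  rewrite euler_op !tpow_op dT_op !op_mul.
  apply: endT_eq => f; apply: laurentP => i; rewrite endTD endTZ coefTD.
  rewrite coefTZ !coef_op !(hornerM, horner_comp, hornerD, hornerX, hornerC).
  rewrite addrK add0r; have -> : i - x.1.2 = i - (x.1.2 + 1 - 1) by lia.
  by rewrite !(rmorphB, rmorphD, rmorphN) /=; ring.
by apply: homTD; [apply: homT_base; lia|apply/homTZ/homT_base].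
Qed.

(** Both [t^n] and [\partial] are of the form [op d p], a form stable under
    products. Conversely [op d p] is also a polynomial in [E] times [t^d], by the
    commutation rule, so that [homT_euler] applies. *)
Lemma homTP d P : homT d P <-> exists p, P = op d p.
Proof.
split=> [[s [hs ->]]|[p ->]].
  elim: s hs => [|[[c n] m] s IH] hs; first by exists 0; rewrite big_nil op0.
  rewrite big_cons; have [|q ->] := IH.
    by move=> x xs; apply: hs; rewrite inE xs orbT.
  have /= hd := hs _ (mem_head _ _); have [p ->] := dTX_op m.
  by rewrite tpow_op op_mul -hd -op_lin; eexists.
have -> : op d p = op 0 (p \Po ('X - d%:~R%:P)) * tpow R d.
  rewrite tpow_op op_mul mulr1 add0r -comp_polyA comp_polyB comp_polyX comp_polyC.
  by rewrite addrK comp_polyXr.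
elim/poly_ind: (p \Po _) => [|q c IH]; first by rewrite op0 mul0r; exact: homT0.
have -> : op 0 (q * 'X + c%:P) * tpow R d = E * (op 0 q * tpow R d) + c *: tpow R d.
  rewrite mulrA euler_op op_mul -alg_polyC addr0 comp_polyX mulrC opD opZ -one_op.
  by rewrite polyC0 addr0 mulrDl -scalerAl mul1r.
apply: homTD; first exact: homT_euler.
by apply: homTZ; rewrite -[tpow R d]mulr1; apply: (@homT_base d d 0); rewrite subr0.
Qed.

Lemma homT1 : homT 0 (1 : endT).
Proof. by apply/homTP; exists 1; exact: one_op. Qed.

Lemma homT_mul d e P Q : homT d P -> homT e Q -> homT (d + e) (P * Q).
Proof. by move=> /homTP[p ->] /homTP[q ->]; apply/homTP; rewrite op_mul; eexists. Qed.

End HomogeneousOperators.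

(** * Sums of homogeneous elements *)

Section HomogeneousSums.
Variables (V : zmodType) (h : int -> set V).
Hypothesis h_sub : forall i, h i 0 /\ (forall x y, h i x -> h i y -> h i (x - y)).

Lemma hom_zero i : h i 0. Proof. by case: (h_sub i). Qed.
Lemma hom_sub i x y : h i x -> h i y -> h i (x - y).
Proof. by case: (h_sub i) => _; apply. Qed.
Lemma hom_add i x y : h i x -> h i y -> h i (x + y).
Proof.
move=> hx hy; rewrite -[y]opprK; apply: hom_sub => //.
by rewrite -sub0r; apply: hom_sub => //; exact: hom_zero.
Qed.

Lemma hom_collect (u : seq V) : (forall y, y \in u -> exists i, h i y) ->
  exists (s : seq int) (c : int -> V),
    [/\ uniq s, forall i, h i (c i) & \sum_(y <- u) y = \sum_(i <- s) c i].
Proof.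
elim: u => [|y u IH] hu.
  by exists [::], (fun=> 0); rewrite !big_nil; split=> // i; exact: hom_zero.
have [z zu|s [c [us hc sumc]]] := IH; first by apply: hu; rewrite inE zu orbT.
rewrite big_cons sumc; have [i hi] := hu y (mem_head _ _).
pose c' j := if j == i then (if i \in s then y + c i else y) else c j.
have hc' j : h j (c' j).
  rewrite /c'; case: eqP => [->|_]; last exact: hc.
  by case: ifP => _ //; exact: hom_add.
have c'E : \sum_(j <- s | j != i) c' j = \sum_(j <- s | j != i) c j.
  by apply: eq_bigr => j; rewrite /c' => /negbTE->.
have [si|si] := boolP (i \in s).
  exists s, c'; split=> //; rewrite !(bigD1_seq i) //= c'E addrA.
  by rewrite /c' eqxx si.
exists (i :: s), c'; rewrite /= si us; split=> //.
rewrite big_cons [c' i]/c' eqxx (negbTE si); congr (_ + _).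
apply: eq_big_seq => j js; rewrite /c'; case: eqP => // ji.
by rewrite ji (negbTE si) in js.
Qed.

(** Otherwise, subtracting [y] from the term of degree [j] would give a nontrivial
    relation between homogeneous elements. *)
Lemma hom_component (s : seq int) (c : int -> V) j y :
  internal_direct_sum h -> uniq s -> (forall i, h i (c i)) -> h j y ->
  y = \sum_(i <- s) c i -> y = (if j \in s then c j else 0).
Proof.
case=> _ _ dir us hc hy ysum.
pose c1 i := if i == j then (if j \in s then c j else 0) - y else c i.
have hc1 i : h i (c1 i).
  rewrite /c1; case: eqP => [->|_]; last exact: hc.
  by apply: hom_sub => //; case: ifP => _ //; exact: hom_zero.
have c1E : \sum_(i <- s | i != j) c1 i = \sum_(i <- s | i != j) c i.
  by apply: eq_bigr => i; rewrite /c1 => /negbTE->.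
have [sj|sj] := boolP (j \in s).
  have := dir s c1 us hc1; rewrite (bigD1_seq j) //= c1E [c1 j]/c1 eqxx sj.
  rewrite addrAC -bigD1_seq //= -ysum subrr => /(_ erefl j sj).
  by rewrite /c1 eqxx sj => /eqP; rewrite subr_eq0 => /eqP.
have := dir (j :: s) c1; rewrite /= sj us big_cons [c1 j]/c1 eqxx (negbTE sj).
have -> : \sum_(i <- s) c1 i = \sum_(i <- s) c i.
  apply: eq_big_seq => i i_s; rewrite /c1; case: eqP => // ij.
  by rewrite -ij i_s in sj.
rewrite -ysum sub0r addNr => /(_ isT hc1 erefl j (mem_head _ _)).
by rewrite /c1 eqxx (negbTE sj) sub0r => /eqP; rewrite oppr_eq0 => /eqP.
Qed.

End HomogeneousSums.

(** * Operators preserving spans of monomials *)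

Section OperatorDecomposition.
Variable R : realType.
Local Notation k := R[i].
Local Notation endT := (endT R).

Lemma sum_op_gen (P : endT) : P \in sa_pred (sDiffT R) ->
  exists u : seq (int * {poly k}), P = \sum_(x <- u) op x.1 x.2.
Proof.
have base d p : exists u : seq (int * {poly k}), op d p = \sum_(x <- u) op x.1 x.2.
  by exists [:: (d, p)]; rewrite big_seq1.
rewrite inE; elim=> {P} [P||c P Q _ [u ->] _ [v ->]|P Q _ [u ->] _ [v ->]].
- by case=> [[->|->]|->]; rewrite ?tpow_op ?dT_op.
- by rewrite one_op.
- exists ([seq (x.1, c *: x.2) | x <- u] ++ v).
  rewrite big_cat big_map scaler_sumr; congr (_ + _).
  by apply: eq_bigr => x _; rewrite opZ.
- exists [seq (x.1 + y.1, (x.2 \Po ('X + (y.1%:~R)%:P)) * y.2) | x <- u, y <- v].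
  rewrite big_allpairs_dep /= mulr_suml; apply: eq_bigr => x _.
  by rewrite mulr_sumr; apply: eq_bigr => y _; rewrite op_mul.
Qed.

Lemma sum_op (P : endT) : P \in sa_pred (sDiffT R) ->
  exists (s : seq int) (pc : int -> {poly k}),
    uniq s /\ P = \sum_(d <- s) op d (pc d).
Proof.
move=> /sum_op_gen[u ->].
have [|y /mapP[x _ ->]|s [c [us hc]]] :=
    @hom_collect _ (@homT R) _ [seq op x.1 x.2 | x <- u].
- move=> i; split; first exact: homT0.
  by move=> x y; exact: homTB.
- by exists x.1; apply/homTP; eexists.
rewrite big_map => ->; have [pc hpc] := choice (fun i => (homTP _ _).1 (hc i)).
by exists s, pc; split=> //; apply: eq_bigr => i _.
Qed.

Lemma op_DiffT d p : op d p \in sa_pred (sDiffT R).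
Proof.
have t1 : tpow R 1 \in sa_pred (sDiffT R).
  by rewrite inE; apply: AlgGen_base; left; left.
have tN1 : tpow R (-1) \in sa_pred (sDiffT R).
  by rewrite inE; apply: AlgGen_base; left; right.
have tX (e : int) n : tpow R e \in sa_pred (sDiffT R) ->
    tpow R (e * n%:Z) \in sa_pred (sDiffT R).
  move=> he; elim: n => [|n IH]; first by rewrite mulr0 tpow_op -one_op rpred1.
  have -> : tpow R (e * n.+1%:Z) = tpow R e * tpow R (e * n%:Z).
    rewrite !tpow_op op_mul mulr1 -polyC1 comp_polyC; congr op.
    by rewrite intS mulrDr mulr1.
  by rewrite rpredM.
have -> : op d p = tpow R d * op 0 p.
  by rewrite tpow_op op_mul -polyC1 comp_polyC polyC1 mul1r addr0.
apply: rpredM.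
  by case: d => n; [have := tX _ n t1; rewrite mul1r|
                    have := tX _ n.+1 tN1; rewrite mulN1r NegzE].
elim/poly_ind: p => [|p c IH]; first by rewrite op0 rpred0.
have -> : op 0 (p * 'X + c%:P) = op 0 p * eulerT R + c *: 1.
  by rewrite euler_op op_mul polyC0 !addr0 comp_polyXr -alg_polyC opD opZ -one_op.
by rewrite rpredD ?rpredZ ?rpred1 // rpredM // eulerT_DiffT.
Qed.

Lemma coef_sum_op (s : seq int) (pc : int -> {poly k}) d (n : int) :
  uniq s -> d \in s ->
  coefT ((\sum_(e <- s) op e (pc e)) (monomT R n)) (n + d) = (pc d).[n%:~R].
Proof.
move=> us sd; rewrite endT_sum coefT_sum (bigD1_seq d) // op_monom eqxx mul1r.
rewrite big1 => [|e /negbTE ed]; first exact: addr0.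
by rewrite op_monom (inj_eq (addrI n)) eq_sym ed mul0r.
Qed.

End OperatorDecomposition.

Section SemigroupOperators.
Variables (R : realType) (Gamma : numerical_semigroup).
Local Notation k := R[i].
Local Notation endT := (endT R).

Definition in_semigroup (z : int) : Prop := exists2 n, ns_set Gamma n & z = n%:Z.

Lemma semigroup_conductor : exists c : nat, forall n : nat, (c <= n)%N -> ns_set Gamma n.
Proof.
have /finite_seqP[s hs] := ns_cofinite Gamma.
exists (\max_(n <- s) n).+1 => n hn; apply: contrapT => nG.
have ns : n \in s by move: nG; rewrite -[~ _]/((~` ns_set Gamma) n) hs.
by have := @leq_bigmax_seq _ s xpredT id n ns isT; lia.
Qed.

(** The polynomials [p] such that [t^d p(E)] maps the span of the [t^n],
    [n \in X], into the algebra of the semigroup. *)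
Definition admissible (X : set nat) d (p : {poly k}) : Prop :=
  forall n : nat, X n -> ~ in_semigroup (n%:Z + d) -> p.[n%:R] = 0.

Definition preserves (X : set nat) (P : endT) : Prop :=
  forall f, f \in monspan X -> P f \in curveT Gamma.

Lemma monspanP (X : set nat) (f : laurent R) : reflect
  (forall i : int, coefT f i <> 0 -> exists2 n, X n & i = n%:Z) (f \in monspan X).
Proof. exact: asboolP. Qed.

Lemma monomT_monspan (X : set nat) n : X n -> monomT R n%:Z \in monspan X.
Proof.
by move=> Xn; apply/monspanP => i /=; case: eqP => [-> _|//]; exists n.
Qed.

Lemma op_preserves X d p : preserves X (op d p) <-> admissible X d p.
Proof.
split=> [h n Xn hn|h f /monspanP hf].
  apply: contrapT => pn; apply: hn.
  have /monspanP := h _ (monomT_monspan Xn); apply.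
  by rewrite op_monom eqxx mul1r -pmulrn.
apply/monspanP => i; rewrite coef_op => nz.
have [|n Xn hn] := hf (i - d); first by move=> f0; apply: nz; rewrite f0 mulr0.
apply: contrapT => hi; apply: nz; rewrite hn -pmulrn h ?mul0r // -hn subrK.
by move=> [m Gm ?]; apply: hi; exists m.
Qed.

(** Only the component of degree [d] contributes to the coefficient of
    [t^(n + d)] in the image of [t^n]. This makes [D], as well as [D(B, A)],
    graded. *)
Lemma sum_op_preserves X (s : seq int) (pc : int -> {poly k}) : uniq s ->
  preserves X (\sum_(d <- s) op d (pc d)) ->
  forall d, d \in s -> preserves X (op d (pc d)).
Proof.
move=> us h d sd; apply/op_preserves => n Xn hn; apply: contrapT => pn; apply: hn.
have /monspanP := h _ (monomT_monspan Xn); apply.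
by rewrite coef_sum_op // -pmulrn.
Qed.

(** Only finitely many exponents constrain an admissible polynomial, because
    [Gamma] has finite complement; the product of the corresponding linear
    factors has no other root.  *)
Lemma admissible_nonroot (X : set nat) d (w : k) :
  (forall n : nat, X n -> ~ in_semigroup (n%:Z + d) -> w <> n%:R) ->
  exists p, admissible X d p /\ p.[w] <> 0.
Proof.
move=> hw; have [c hc] := semigroup_conductor.
pose bad (n : nat) := `[< X n /\ ~ in_semigroup (n%:Z + d) >].
exists (\prod_(n <- [seq n <- iota 0 (c + absz d) | bad n]) ('X - (n%:R)%:P)); split.
  move=> n Xn hn; have badn : bad n by apply/asboolP.
  rewrite horner_prod (bigD1_seq n) ?filter_uniq ?iota_uniq //=.
    by rewrite hornerXsubC subrr mul0r.
  rewrite mem_filter badn mem_iota /= ltnNge; apply/negP => le; apply: hn.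
  exists (absz (n%:Z + d)); last by lia.
  by apply: hc; lia.
rewrite horner_prod; apply/eqP; rewrite prodf_seq_neq0; apply/allP => n.
rewrite mem_filter => /andP[/asboolP[Xn hn] _] /=; rewrite hornerXsubC subr_eq0.
by apply/eqP; exact: hw.
Qed.

End SemigroupOperators.

(** * Weights *)

Lemma sa_val_sum (R : realType) (S : subalgebra R) I (s : seq I) (F : I -> sa_type S) :
  sa_val (\sum_(x <- s) F x) = \sum_(x <- s) sa_val (F x).
Proof. by apply: (big_rec2 (fun u v => sa_val u = v)) => // x u v _ <-. Qed.

Section Weights.
Variables (R : realType) (S : subalgebra R) (e : sa_type S).
Hypothesis eE : sa_val e = eulerT R.
Local Notation k := R[i].
Local Notation L := (sa_gr S).
Variable M : lmodType (sa_type S).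
Implicit Types (x y : M) (c w : k) (r : sa_type S).

Definition kscale c x : M := (c *: (1 : sa_type S)) *: x.
Definition weight w x : Prop := e *: x = kscale w x.

Lemma kscaleA c c' x : kscale c (kscale c' x) = kscale (c * c') x.
Proof. by rewrite /kscale scalerA -scalerAl mul1r scalerA. Qed.
Lemma kscale1 x : kscale 1 x = x. Proof. by rewrite /kscale !scale1r. Qed.
Lemma kscale0l x : kscale 0 x = 0. Proof. by rewrite /kscale !scale0r. Qed.
Lemma kscale0r c : kscale c 0 = 0. Proof. exact: scaler0. Qed.
Lemma kscaleDl c c' x : kscale (c + c') x = kscale c x + kscale c' x.
Proof. by rewrite /kscale !scalerDl. Qed.
Lemma kscaleDr c x y : kscale c (x + y) = kscale c x + kscale c y.
Proof. exact: scalerDr. Qed.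
Lemma kscaleN c x : kscale (- c) x = - kscale c x.
Proof. by rewrite /kscale !scaleNr. Qed.
Lemma scaler_kscale c r x : r *: kscale c x = kscale c (r *: x).
Proof. by rewrite /kscale !scalerA -scalerAl -scalerAr mulr1 mul1r. Qed.
Lemma kscaleZ c r x : (c *: r) *: x = kscale c (r *: x).
Proof. by rewrite /kscale scalerA -scalerAl mul1r. Qed.

Lemma kscale_eq0 c x : kscale c x = 0 -> c = 0 \/ x = 0.
Proof.
have [->|c0] := eqVneq c 0; first by left.
by move=> h; right; rewrite -[x]kscale1 -(mulVf c0) -kscaleA h kscale0r.
Qed.

Lemma weight_kscale w c x : weight w x -> weight w (kscale c x).
Proof. by move=> h; rewrite /weight scaler_kscale h !kscaleA mulrC. Qed.
Lemma weight0 w : weight w 0.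
Proof. by rewrite /weight scaler0 kscale0r. Qed.
Lemma weightD w x y : weight w x -> weight w y -> weight w (x + y).
Proof. by rewrite /weight scalerDr kscaleDr => -> ->. Qed.
Lemma weight_uniq w w' x : x <> 0 -> weight w x -> weight w' x -> w = w'.
Proof.
rewrite /weight => x0 -> h; have /kscale_eq0[/eqP|//] : kscale (w - w') x = 0.
  by rewrite kscaleDl kscaleN h subrr.
by rewrite subr_eq0 => /eqP.
Qed.

Lemma sa_val_horner p : sa_val (horner_alg e p) = op 0 p.
Proof.
elim/poly_ind: p => [|p c IH]; first by rewrite rmorph0 op0.
rewrite rmorphD rmorphM /= horner_algX horner_algC.
rewrite -[LHS]/(sa_val (horner_alg e p) * sa_val e + c *: 1) IH eE euler_op.
rewrite op_mul polyC0 !addr0 comp_polyXr one_op -opZ -opD.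
by rewrite alg_polyC.
Qed.

Lemma horner_act p w x : weight w x -> horner_alg e p *: x = kscale p.[w] x.
Proof.
move=> wx; elim/poly_ind: p => [|p c IH].
  by rewrite rmorph0 scale0r horner0 kscale0l.
rewrite rmorphD rmorphM /= horner_algX horner_algC hornerMXaddC.
rewrite scalerDl -scalerA wx scaler_kscale IH kscaleA mulrC kscaleDl.
by congr (_ + _); rewrite mulrC.
Qed.

(** Operators of degree zero are polynomials in [E], and so act on a weight
    vector by a scalar. *)
Lemma op0_act r p w x : sa_val r = op 0 p -> weight w x -> r *: x = kscale p.[w] x.
Proof.
move=> rp wx; rewrite -(horner_act p wx); congr (_ *: _).
by apply: val_inj; rewrite /= sa_val_horner.
Qed.

Lemma op_weight r d w x : homT d (sa_val r) -> weight w x -> weight (w + d%:~R) (r *: x).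
Proof.
move=> /homTP[p rp] wx; rewrite /weight scalerA.
have -> : e * r = r * e + d%:~R *: r.
  apply: val_inj; rewrite -[LHS]/(sa_val e * sa_val r).
  rewrite -[RHS]/(sa_val r * sa_val e + d%:~R *: sa_val r) rp eE euler_op.
  rewrite !op_mul -opZ addr0 add0r polyC0 addr0 comp_polyXr comp_polyX -opD.
  by rewrite mulrDl mulrC mul_polyC.
by rewrite scalerDl kscaleZ -scalerA wx scaler_kscale -kscaleDl.
Qed.

(** The usual argument for eigenvectors with distinct eigenvalues. It
    makes the sum of the homogeneous pieces direct when [E] acts on the piece of
    degree [i] by [w + i]. *)
Lemma weight_independent (w : k) (s : seq int) (c : int -> M) : uniq s ->
  (forall i, weight (w + i%:~R) (c i)) -> \sum_(i <- s) c i = 0 ->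
  forall i, i \in s -> c i = 0.
Proof.
move=> + wc; elim: s c wc => [|j s IH] c wc //= /andP[js us].
rewrite big_cons => sum0.
(* [E - (w + j)] kills [c j] and multiplies the other terms by [i - j]. *)
have wc' i : weight (w + i%:~R) (kscale (i - j)%:~R (c i)) by exact: weight_kscale.
have sum' : \sum_(i <- s) kscale (i - j)%:~R (c i) = 0.
  have : e *: (c j + \sum_(i <- s) c i) - kscale (w + j%:~R) (c j + \sum_(i <- s) c i) = 0.
    by rewrite sum0 scaler0 kscale0r subr0.
  rewrite scalerDr kscaleDr wc opprD addrACA subrr add0r => {2}<-.
  rewrite scaler_sumr /kscale scaler_sumr -sumrB; apply: eq_bigr => l _.
  by rewrite wc -kscaleN -kscaleDl; congr kscale; rewrite rmorphB /=; ring.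
have cs i : i \in s -> c i = 0.
  move=> si; have /kscale_eq0[/eqP|//] := IH _ wc' us sum' i si.
  by rewrite intr_eq0 subr_eq0 => /eqP ij; rewrite -ij si in js.
move=> i; rewrite inE => /orP[/eqP->|/cs//].
by move: sum0; rewrite big1_seq ?addr0 // => l /andP[_ /cs].
Qed.

End Weights.

(** * Graded isomorphisms and twists *)

Section GradedIso.
Variable L : grRing.
Implicit Types M N X Y Z : grMod L.

Lemma gr_iso_sym M N : gr_iso M N -> gr_iso N M.
Proof.
move=> [f [[g fK gK] hf]].
pose G : {linear N -> M} := HB.pack g (GRing.isLinear.Build _ _ _ _ g (can2_linear fK gK)).
exists G; split; first by exists f.
by move=> i x; rewrite (hf i (g x)) gK.
Qed.

Lemma twist_sum n M (s : seq int) (c : int -> M) :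
  \sum_(i <- s) c i = \sum_(i <- [seq i - n | i <- s]) c (n + i).
Proof. by rewrite big_map; apply: eq_bigr => i _; rewrite addrC subrK. Qed.

Lemma twist_simple n M : simple_graded M -> simple_graded (twist n M).
Proof.
have inj : injective (fun i : int => i - n) by move=> i j /addIr.
have inj' : injective (fun i : int => n + i) by move=> i j /addrI.
case=> [[[h0 hs hd] hr] nz hN]; split=> //.
- split; last by move=> i j r x hr' hx; rewrite /= addrCA; exact: hr.
  split=> [i|x|s c us hc sum0 i si]; first exact: h0.
    have [s [c [us hc ->]]] := hs x; exists [seq i - n | i <- s], (fun i => c (n + i)).
    by rewrite map_inj_uniq // -twist_sum; split=> // i; exact: hc.
  have ci j : c (n + j - n) = c j by rewrite [n + j]addrC addrK.
  rewrite -ci; apply: (hd [seq n + j | j <- s] (fun j => c (j - n))).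
  + by rewrite map_inj_uniq.
  + by move=> j; have := hc (j - n); rewrite /= addrC subrK.
  + by rewrite big_map -[RHS]sum0; apply: eq_bigr => j _; exact: ci.
  + exact: map_f.
- move=> N [sN hN']; apply: hN; split=> // x /hN'[s [c [us hc ->]]].
  exists [seq n + i | i <- s], (fun i => c (i - n)).
  rewrite map_inj_uniq // big_map; split=> //.
    by move=> i; have := hc (i - n); rewrite /= [n + _]addrC subrK.
  by apply: eq_bigr => j _; rewrite [n + _]addrC addrK.
Qed.

End GradedIso.

(** * Simple graded modules over a graded ring of operators *)

Section SimpleModules.
Variables (R : realType) (S : subalgebra R) (e : sa_type S).
Hypothesis eE : sa_val e = eulerT R.
Hypothesis S_graded : forall r : sa_type S, exists (s : seq int) (c : int -> sa_type S),
  [/\ uniq s, forall i, homT i (sa_val (c i)) & r = \sum_(i <- s) c i].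
Local Notation k := R[i].
Local Notation L := (sa_gr S).
Implicit Types (M X Y : grMod L) (r : sa_type S).

Lemma graded_of_weights M (w : k) :
  (forall i, gm_hom i (0 : M) /\
     (forall x y : M, gm_hom i x -> gm_hom i y -> gm_hom i (x - y))) ->
  (forall x : M, exists u : seq M,
     (forall y, y \in u -> exists i, gm_hom i y) /\ x = \sum_(y <- u) y) ->
  (forall i j r (x : M), homT i (sa_val r) -> gm_hom j x -> gm_hom (i + j) (r *: x)) ->
  (forall i (x : M), gm_hom i x -> weight e (w + i%:~R) x) ->
  is_graded_module M.
Proof.
move=> h0 hs hr hw; split; last exact: hr; split=> // [x|s c us hc].
  by have [u [hu ->]] := hs x; exact: hom_collect.
by apply: weight_independent => // i; apply: hw.
Qed.

(** A nonzero graded submodule contains a nonzero homogeneous element, from which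
    all homogeneous elements are reached. *)
Lemma simple_of_transitive M : is_graded_module M -> (exists x : M, x <> 0) ->
  (forall i j (x y : M), gm_hom i x -> x <> 0 -> gm_hom j y ->
     exists r, r *: x = y) -> simple_graded M.
Proof.
move=> gM nz tr; split=> // N [[N0 ND NZ] hN].
have [[x [Nx x0]]|none] := pselect (exists x : M, N x /\ x <> 0); last first.
  left; apply/seteqP; split=> x /=; last by move->.
  by move=> Nx; apply: contrapT => x0; apply: none; exists x.
right; apply/seteqP; split=> // y _.
have [s [c [us hc xE]]] := hN x Nx.
have [i [si ci]] : exists i, i \in s /\ c i <> 0.
  apply: contrapT => no; apply: x0; rewrite xE big1_seq // => i /andP[_ si].
  by apply: contrapT => ci; apply: no; exists i.
have [[_ hs _] _] := gM; have [s' [c' [_ hc' ->]]] := hs y.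
apply: big_ind => // j _; have [r <-] := tr _ _ _ _ (hc i).1 ci (hc' j).
by apply: NZ; case: (hc i).
Qed.

Section OneSimple.
Variable M : grMod L.
Hypothesis sM : simple_graded M.

Let hM : internal_direct_sum (@gm_hom L M). Proof. by case: sM => [[]]. Qed.
Let hM0 : forall i, gm_hom i (0 : M) /\
  (forall x y : M, gm_hom i x -> gm_hom i y -> gm_hom i (x - y)).
Proof. by case: hM. Qed.
Let hMr i j r (x : M) : homT i (sa_val r) -> gm_hom j x -> gm_hom (i + j) (r *: x).
Proof. by case: sM => [[_ h]] _ _; apply: h. Qed.

(** The component [c j] is indexed by the degree [j] of [c j *: x], not by its own
    degree [j - i], to fit the decomposition of [r *: x]. *)
Lemma scale_components r i (x : M) : gm_hom i x ->
  exists (s : seq int) (c : int -> sa_type S),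
  [/\ uniq s, forall j, homT (j - i) (sa_val (c j)), forall j, gm_hom j (c j *: x)
     & r = \sum_(j <- s) c j].
Proof.
move=> hx; have [s [c [us hc ->]]] := S_graded r.
exists [seq j + i | j <- s], (fun j => c (j - i)).
rewrite map_inj_uniq => [|j l /addIr//]; split=> //.
  by move=> j; rewrite -{1}[j](subrK i); apply: hMr.
by rewrite big_map; apply: eq_bigr => j _; rewrite addrK.
Qed.

Lemma simple_cyclic i (x y : M) : gm_hom i x -> x <> 0 -> exists r, r *: x = y.
Proof.
move=> hx x0; have [_ _ /(_ [set z | exists r, r *: x = z])] := sM.
case=> [|N0|NT].
- split; first split.
  + by exists 0; rewrite scale0r.
  + by move=> _ _ [r <-] [r' <-]; exists (r + r'); rewrite scalerDl.
  + by move=> r' _ [r <-]; exists (r' * r); rewrite scalerA.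
  move=> _ [r <-]; have [s [c [us _ hc ->]]] := scale_components r hx.
  exists s, (fun j => c j *: x); rewrite scaler_suml; split=> // j.
  by split=> //; exists (c j).
- have : [set z | exists r, r *: x = z] x by exists 1; rewrite scale1r.
  by rewrite N0.
by have : [set z | exists r, r *: x = z] y by rewrite NT.
Qed.

Lemma simple_transitive i j (x y : M) : gm_hom i x -> x <> 0 -> gm_hom j y ->
  exists r, homT (j - i) (sa_val r) /\ r *: x = y.
Proof.
move=> hx x0 hy; have [r rx] := simple_cyclic y hx x0.
have [s [c [us hc hcx rE]]] := scale_components r hx.
have yE : y = \sum_(j <- s) c j *: x by rewrite -scaler_suml -rE.
have := hom_component hM0 hM us hcx hy yE; case: ifP => _ ->.
  by exists (c j).
by exists 0; split; [exact: homT0|rewrite scale0r].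
Qed.

Lemma simple_weight i j (x y : M) w : gm_hom i x -> x <> 0 -> weight e w x ->
  gm_hom j y -> weight e (w + (j - i)%:~R) y.
Proof.
move=> hx x0 wx hy; have [r [hr <-]] := simple_transitive hx x0 hy.
exact: op_weight.
Qed.

(** A nonzero homogeneous [x] satisfies [x = p(E) E x] unless [E x = 0]; hence
    it is killed by a nonzero polynomial in [E], which has an eigenvector
    among the multiples of [x] because the field is algebraically closed. *)
Lemma simple_eigenvector : exists i (x : M) w, [/\ gm_hom i x, x <> 0 & weight e w x].
Proof.
have [z [i [hz z0]]] : exists z : M, exists i, gm_hom i z /\ z <> 0.
  have [_ [x x0] _] := sM; have [_ hs _] := hM; have [s [c [us hc xE]]] := hs x.
  apply: contrapT => no; apply: x0; rewrite xE big1_seq // => i _.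
  by apply: contrapT => ci; apply: no; exists (c i), i.
have he : homT 0 (sa_val e) by rewrite eE euler_op; apply/homTP; eexists.
have hp p (x : M) : gm_hom i x -> gm_hom i (horner_alg e p *: x).
  move=> hx; rewrite -(add0r i); apply: hMr => //.
  by rewrite (sa_val_horner eE); apply/homTP; eexists.
suff key : forall n (q : {poly k}) (x : M), (size q < n)%N -> q <> 0 -> gm_hom i x ->
    x <> 0 -> horner_alg e q *: x = 0 ->
    exists i (x : M) w, [/\ gm_hom i x, x <> 0 & weight e w x].
  have hez : gm_hom i (e *: z) by rewrite -(add0r i); apply: hMr.
  have [ez0|ez0] := pselect (e *: z = 0).
    by exists i, z, 0; split=> //; rewrite /weight ez0 kscale0l.
  have [r [hr rz]] := simple_transitive hez ez0 hz.
  move: hr; rewrite subrr => /homTP[p rp].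
  have {rp}rE : r = horner_alg e p.
    by apply: val_inj; rewrite /= (sa_val_horner eE).
  apply: (key _ (p * 'X - 1) z (leqnn _) _ hz z0).
    move=> /(congr1 (horner^~ 0)); rewrite !hornerE => /eqP.
    by rewrite oppr_eq0 oner_eq0.
  by rewrite rmorphB rmorphM rmorph1 /= horner_algX -rE scalerBl -scalerA rz scale1r subrr.
elim=> // n IH q x sq q0 hx x0 qx.
have [/size1_polyC qc|] := leqP (size q) 1%N.
  move: qx q0; rewrite qc horner_algC => qx q0.
  by have [/= c0|//] := kscale_eq0 qx; case: q0; rewrite c0.
move=> sq1; have /closed_rootP[a /factor_theorem[q' qE]] : size q != 1%N.
  by rewrite neq_ltn sq1 orbT.
have q'0 : q' <> 0 by move=> q'0; apply: q0; rewrite qE q'0 mul0r.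
have [ax|ax] := pselect (horner_alg e ('X - a%:P) *: x = 0).
  exists i, x, a; split=> //; move/eqP: ax.
  by rewrite rmorphB /= horner_algX horner_algC scalerBl subr_eq0 => /eqP.
apply: (IH q' (horner_alg e ('X - a%:P) *: x)) => //; last 2 first.
- exact: hp.
- by rewrite scalerA -rmorphM -qE.
move: sq; rewrite qE size_Mmonic ?monicXsubC //; last exact/eqP.
by rewrite size_XsubC addn2.
Qed.

End OneSimple.

(** Let [r] be homogeneous with [r y <> 0]. As [Y] is simple, [s r y = y] for some
    homogeneous [s]. The operator [s r], of degree zero, acts on [x] and [y] by
    the same scalar, namely [1]; thus [r x <> 0]. *)
Lemma weight_kernel X Y i (x : X) (y : Y) w r : simple_graded X -> simple_graded Y ->
  gm_hom i x -> x <> 0 -> weight e w x -> gm_hom i y -> y <> 0 -> weight e w y ->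
  r *: x = 0 -> r *: y = 0.
Proof.
move=> sX sY hx x0 wx hy y0 wy rx.
have homog j r' : homT (j - i) (sa_val r') -> r' *: x = 0 -> r' *: y = 0.
  move=> hr r'x; apply: contrapT => ry.
  have hry : gm_hom j (r' *: y).
    by case: sY => [[_ h]] _ _; rewrite -(subrK i j); apply: h.
  have [r2 [hr2 r2y]] := simple_transitive sY hry ry hy.
  have [p pE] : exists p, sa_val (r2 * r') = op 0 p.
    have [p1 h1] := (homTP _ _).1 hr; have [p2 h2] := (homTP _ _).1 hr2.
    rewrite -[sa_val _]/(sa_val r2 * sa_val r') h1 h2 op_mul; eexists; congr op.
    by lia.
  have p1 : p.[w] = 1.
    have : kscale (p.[w] - 1) y = 0.
      by rewrite kscaleDl kscaleN kscale1 -(op0_act eE pE wy) -scalerA r2y subrr.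
    by case/kscale_eq0 => // /eqP; rewrite subr_eq0 => /eqP.
  by apply: x0; rewrite -[x]kscale1 -p1 -(op0_act eE pE wx) -scalerA r'x scaler0.
have [s [c [us hc hcx rE]]] := scale_components sX r hx.
have [[[_ _ dir] _] _ _] := sX.
have c0 j : j \in s -> c j *: x = 0.
  by have := dir s (fun j => c j *: x) us hcx; apply; rewrite -scaler_suml -rE.
rewrite rE scaler_suml big1_seq // => j /andP[_ /c0]; exact: homog.
Qed.

(** As [X] and [Y] are generated by [x] and [y], and the same operators kill
    [x] and [y], the rule [r x |-> r y] is a well-defined isomorphism. *)
Theorem simple_iso_of_weight X Y i (x : X) (y : Y) w :
  simple_graded X -> simple_graded Y ->
  gm_hom i x -> x <> 0 -> weight e w x -> gm_hom i y -> y <> 0 -> weight e w y ->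
  gr_iso X Y.
Proof.
move=> sX sY hx x0 wx hy y0 wy.
have kXY r : r *: x = 0 -> r *: y = 0 by exact: weight_kernel hx x0 wx hy y0 wy.
have kYX r : r *: y = 0 -> r *: x = 0 by exact: weight_kernel hy y0 wy hx x0 wx.
have exy r r' : r *: x = r' *: x -> r *: y = r' *: y.
  by move=> h; apply/eqP; rewrite -subr_eq0 -scalerBl kXY // scalerBl h subrr.
have eyx r r' : r *: y = r' *: y -> r *: x = r' *: x.
  by move=> h; apply/eqP; rewrite -subr_eq0 -scalerBl kYX // scalerBl h subrr.
have [f fx] := choice (fun z => simple_cyclic sX z hx x0).
have [g gy] := choice (fun z => simple_cyclic sY z hy y0).
have lin : linear (fun z : X => (f z *: y : Y)).
  move=> a u v; rewrite scalerA -scalerDl; apply: exy.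
  by rewrite scalerDl -scalerA !fx.
pose F : {linear X -> Y} := HB.pack (fun z : X => (f z *: y : Y))
  (GRing.isLinear.Build _ _ _ _ (fun z : X => (f z *: y : Y)) lin).
exists F; split.
  exists (fun z => g z *: x) => z /=.
    by rewrite -[RHS]fx; apply: eyx; rewrite gy.
  by rewrite -[RHS]gy; apply: exy; rewrite fx.
move=> j z; split=> hz.
  have [r [hr rx]] := simple_transitive sX hx x0 hz.
  have -> : F z = r *: y by apply: exy; rewrite fx rx.
  by case: sY => [[_ h]] _ _; rewrite -(subrK i j); apply: h.
have [r [hr ry]] := simple_transitive sY hy y0 hz.
have -> : z = r *: x by rewrite -[LHS]fx; apply: eyx; rewrite ry.
by case: sX => [[_ h]] _ _; rewrite -(subrK i j); apply: h.
Qed.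

End SimpleModules.

(** * Weights of simple modules over the ring of a monomial curve *)

Section CurveModules.
Variables (R : realType) (Gamma : numerical_semigroup).
Local Notation k := R[i].
Local Notation D := (sa_type (sDiffA R Gamma)).
Local Notation e := (eulerA R Gamma).
Local Notation G := (ns_set Gamma).
Implicit Types (M X Y : grMod (DiffA R Gamma)) (r : D) (p : {poly k}) (w : k).

Let eE : sa_val e = eulerT R. Proof. by []. Qed.

Lemma op_DiffA d p : admissible Gamma G d p -> exists r : D, sa_val r = op d p.
Proof.
move=> /op_preserves h; have hr : op d p \in sDiffA_pred Gamma.
  by apply/sDiffA_predP; split=> //; exact: op_DiffT.
by exists (@SaElt _ (sDiffA R Gamma) _ hr).
Qed.

Lemma DiffA_admissible r d p : sa_val r = op d p -> admissible Gamma G d p.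
Proof. by move=> rp; apply/op_preserves => f hf; rewrite -rp; exact: DiffA_curveT. Qed.

Lemma DiffA_graded r : exists (s : seq int) (c : int -> D),
  [/\ uniq s, forall i, homT i (sa_val (c i)) & r = \sum_(i <- s) c i].
Proof.
have [s [pc [us rE]]] := sum_op (DiffA_DiffT r).
have comp i : exists c : D, sa_val c = op i (if i \in s then pc i else 0).
  apply: op_DiffA; case: ifP => [si|_]; last by move=> *; rewrite horner0.
  apply/op_preserves; apply: (sum_op_preserves us) si => f hf.
  by rewrite -rE; exact: DiffA_curveT.
have [c hc] := choice comp.
exists s, c; split=> //; first by move=> i; apply/homTP; rewrite hc; eexists.
apply: val_inj; rewrite /= sa_val_sum rE; apply: eq_big_seq => i si.
by rewrite hc si.
Qed.

Definition semigroup_weight w : Prop := exists2 n, G n & w = n%:R.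

Lemma semigroup_weight_int (z : int) : semigroup_weight z%:~R <-> in_semigroup Gamma z.
Proof.
split=> -[n Gn h]; exists n => //; last by rewrite h -pmulrn.
by apply/eqP; rewrite -(eqr_int k) h -pmulrn.
Qed.

Section OneSimple.
Variables (M : grMod (DiffA R Gamma)) (i : int) (x : M) (w : k).
Hypotheses (sM : simple_graded M) (hx : gm_hom i x) (x0 : x <> 0) (wx : weight e w x).

(** Let [y = r x] and [x = s y], with [r = t^d p(E)] and [s = t^(- d) q(E)]. Then
    [x = s r x = q(w + d) p(w) x], so [p(w) <> 0]; but [p] vanishes at the elements
    of [Gamma] that the translation by [d] sends out of [Gamma]. *)
Lemma simple_semigroup_weight j (y : M) : gm_hom j y -> y <> 0 ->
  semigroup_weight w -> semigroup_weight (w + (j - i)%:~R).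
Proof.
move=> hy y0 [n Gn wn].
have [r [/homTP[p rp] rx]] := simple_transitive DiffA_graded sM hx x0 hy.
have [s [/homTP[q sq] sy]] := simple_transitive DiffA_graded sM hy y0 hx.
have [m Gm hm] : in_semigroup Gamma (n%:Z + (j - i)).
  apply: contrapT => hn; apply: x0.
  have srE : sa_val (s * r) = op 0 ((q \Po ('X + ((j - i)%:~R)%:P)) * p).
    by rewrite -[LHS]/(sa_val s * sa_val r) rp sq op_mul; congr op; lia.
  rewrite -sy -rx scalerA (op0_act eE srE wx) hornerM wn.
  by rewrite (DiffA_admissible rp Gn hn) mulr0 kscale0l.
by exists m => //; rewrite wn pmulrn -intrD hm -pmulrn.
Qed.

(** By [admissible_nonroot], some [r] of degree [d] and some [s] of degree [- d] in
    [D] are such that [s r] acts on [x] by a nonzero scalar; hence [r x <> 0]. *)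
Lemma simple_next_weight d :
  (semigroup_weight w <-> semigroup_weight (w + d%:~R)) ->
  exists y : M, gm_hom (i + d) y /\ y <> 0.
Proof.
move=> hw; have [p [ap pw]] : exists p, admissible Gamma G d p /\ p.[w] <> 0.
  apply: admissible_nonroot => n Gn hn wn; apply: hn.
  have [|m Gm] := hw.1; first by exists n.
  by move=> hm; exists m => //; apply/eqP; rewrite -(eqr_int k) intrD -!pmulrn -wn hm.
have [q [aq qw]] : exists q, admissible Gamma G (- d) q /\ q.[w + d%:~R] <> 0.
  apply: admissible_nonroot => n Gn hn wn; apply: hn.
  have [|m Gm] := hw.2; first by exists n.
  move=> hm; exists m => //; apply/eqP.
  by rewrite -(eqr_int k) intrD -!pmulrn -wn hm rmorphN addrK.
have [r rp] := op_DiffA ap; have [s sq] := op_DiffA aq.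
exists (r *: x); split.
  case: sM => [[_ h]] _ _; rewrite addrC; apply: h => //.
  by apply/homTP; exists p.
move=> rx; have srE : sa_val (s * r) = op 0 ((q \Po ('X + (d%:~R)%:P)) * p).
  by rewrite -[LHS]/(sa_val s * sa_val r) rp sq op_mul; congr op; lia.
have : (s * r) *: x = 0 by rewrite -scalerA rx scaler0.
rewrite (op0_act eE srE wx) hornerM horner_comp hornerD hornerX hornerC.
by move=> /kscale_eq0[/eqP|//]; rewrite mulf_eq0 => /orP[]/eqP.
Qed.

End OneSimple.

Definition has_weight M w : Prop :=
  exists i (x : M), [/\ gm_hom i x, x <> 0 & weight e w x].

Definition same_class w w' : Prop :=
  exists z : int, w' = w + z%:~R /\ (semigroup_weight w <-> semigroup_weight w').

(** The operators of degree [d] in [D] are the [t^d p(E)] with [p] vanishing on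
    the elements [n] of [Gamma] such that [n + d] is not in [Gamma]. So a
    nonzero vector of weight [w] yields one of weight [w + d], and conversely,
    unless exactly one of these weights lies in [Gamma]. *)
Theorem simple_has_weight M w w' : simple_graded M -> has_weight M w ->
  (has_weight M w' <-> same_class w w').
Proof.
move=> sM [i [x [hx x0 wx]]]; split.
  move=> [j [y [hy y0 wy]]].
  have wE := weight_uniq y0 wy (simple_weight eE DiffA_graded sM hx x0 wx hy).
  exists (j - i); split=> //; split=> [h|].
    by rewrite wE; exact: (simple_semigroup_weight sM hx x0 wx hy y0 h).
  move=> h; have := simple_semigroup_weight sM hy y0 wy hx x0 h.
  by rewrite wE -addrA -intrD addrA subrK subrr addr0.
move=> [z [-> hz]]; have [y [hy y0]] := simple_next_weight sM hx x0 wx hz.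
exists (i + z), y; split=> //.
have := simple_weight eE DiffA_graded sM hx x0 wx hy.
by rewrite [i + z]addrC addrK.
Qed.

Lemma gr_iso_has_weight X Y w : gr_iso X Y -> has_weight X w -> has_weight Y w.
Proof.
move=> [f [bf hf]] [i [x [hx x0 wx]]]; exists i, (f x); split; first exact/hf.
  by move=> fx0; apply: x0; apply: (bij_inj bf); rewrite fx0 linear0.
by rewrite /weight -[LHS]linearZ wx [LHS]linearZ.
Qed.

Lemma twist_has_weight n X w : has_weight (twist n X) w <-> has_weight X w.
Proof.
split=> -[i [x [hx x0 wx]]]; first by exists (n + i), x.
by exists (i - n), x; split=> //; rewrite /= addrC subrK.
Qed.

Lemma simple_weight_exists M : simple_graded M -> exists w, has_weight M w.
Proof.
by move=> /(simple_eigenvector eE DiffA_graded)[i [x [w h]]]; exists w, i, x.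
Qed.

Lemma simple_iso_twist X Y w : simple_graded X -> simple_graded Y ->
  has_weight X w -> has_weight Y w -> exists n, gr_iso X (twist n Y).
Proof.
move=> sX sY [i [x [hx x0 wx]]] [j [y [hy y0 wy]]]; exists (j - i).
apply: (@simple_iso_of_weight _ _ _ eE DiffA_graded X (twist (j - i) Y) i x y w) => //.
  exact: twist_simple.
by rewrite /= subrK.
Qed.

End CurveModules.

(** * Cyclic modules *)

Section CyclicModules.
Variables (L : nzRingType) (a : L).

Lemma cyclic_piE r : cyclic_pi a r = r *: cyclic_pi a 1.
Proof. by rewrite -[RHS]/(cyclic_scale r (cyclic_pi a 1)) cyclic_scaleE mulr1. Qed.

Lemma cyclic_pi0 : cyclic_pi a 0 = 0.
Proof. by rewrite cyclic_piE scale0r. Qed.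

Lemma cyclic_pi_eq0 r : cyclic_pi a r = 0 <-> exists b, r = b * a.
Proof.
rewrite -cyclic_pi0; split=> [/eqP/cyclic_piP|] [b]; rewrite ?subr0 => h.
  by exists b.
by apply/eqP/cyclic_piP; exists b; rewrite subr0.
Qed.

Lemma cyclic_ann : a *: cyclic_pi a 1 = 0.
Proof. by rewrite -cyclic_piE; apply/cyclic_pi_eq0; exists 1; rewrite mul1r. Qed.
End CyclicModules.

Section Models.
Variables (R : realType) (Gamma : numerical_semigroup).
Local Notation k := R[i].
Local Notation D := (sa_type (sDiffA R Gamma)).
Local Notation e := (eulerA R Gamma).
Local Notation G := (ns_set Gamma).
Implicit Types (r : D) (p : {poly k}) (w : k).

Let eE : sa_val e = eulerT R. Proof. by []. Qed.

Lemma horner_shift p (z : int) w : (p \Po ('X + (z%:~R)%:P)).[w] = p.[w + z%:~R].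
Proof. by rewrite horner_comp hornerD hornerX hornerC. Qed.

Lemma coef_monomT n i : coefT (monomT R n) i = (i == n)%:R.
Proof. by []. Qed.

Lemma euler_monomT n : eulerT R (monomT R n) = n%:~R *: monomT R n.
Proof.
apply: laurentP => i; rewrite coef_euler coefTZ /=.
by case: eqP => [->|]; rewrite ?mulr0.
Qed.

(** ** The algebra of the semigroup *)

Lemma curve_weight n (f : Acurve R Gamma) : gm_hom n f -> weight e n%:~R f.
Proof.
move=> [c fc]; apply: val_inj; rewrite -[LHS]/(eulerT R (curve_val f)).
rewrite -[RHS]/(n%:~R *: curve_val f) fc scalerA mulrC -scalerA -euler_monomT.
by apply: laurentP => i; rewrite coefTZ !coef_euler coefTZ mulrCA.
Qed.

Lemma curve_hom_in n (f : Acurve R Gamma) : gm_hom n f -> f <> 0 -> in_semigroup Gamma n.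
Proof.
move=> [c fc] f0; have /monspanP := valP f; apply=> h; apply: f0.
apply: val_inj; rewrite -[LHS]/(curve_val f) fc.
move: h; rewrite -[X in X n]/(coefT (curve_val f)) fc coefTZ coef_monomT eqxx mulr1 => ->.
by rewrite scale0r.
Qed.

Lemma op_monomT d p (n : int) : op d p (monomT R n) = p.[n%:~R] *: monomT R (n + d).
Proof. by apply: laurentP => i; rewrite op_monom coefTZ /= mulrC. Qed.

Lemma endT_scale (P : endT R) c f : P (c *: f) = c *: P f.
Proof. by rewrite -[_ *: f]addr0 endT_linear endT0r addr0. Qed.

Lemma laurent_monomials (f : laurent R) : exists s : seq int, uniq s /\
  f = \sum_(i <- s) coefT f i *: monomT R i.
Proof.
have [m hm] : exists m : nat, forall i : int, (m < absz i)%N -> coefT f i = 0.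
  by case: f => f /= /asboolP.
exists [seq n%:Z - m%:Z | n <- iota 0 (m + m).+1]; split.
  by rewrite map_inj_uniq ?iota_uniq // => n n' /addIr[].
apply: laurentP => i; rewrite coefT_sum.
have [si|si] := boolP (i \in [seq n%:Z - m%:Z | n <- iota 0 (m + m).+1]).
  rewrite (bigD1_seq i) //; last by rewrite map_inj_uniq ?iota_uniq // => n n' /addIr[].
  rewrite coefTZ coef_monomT eqxx mulr1 big1 => [|j /negbTE ij]; first exact: esym (addr0 _).
  by rewrite coefTZ coef_monomT eq_sym ij mulr0.
rewrite big1_seq => [|j /andP[_ js]]; last first.
  by rewrite coefTZ coef_monomT; case: eqP => [ij|]; rewrite ?mulr0 //; rewrite ij js in si.
apply: hm; rewrite ltnNge; apply: contra si => im; apply/mapP.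
by exists (absz (i + m%:Z)); rewrite ?mem_iota; lia.
Qed.

Lemma curve_val_sum I (s : seq I) (F : I -> curve R Gamma) :
  curve_val (\sum_(x <- s) F x) = \sum_(x <- s) curve_val (F x).
Proof. by apply: (big_rec2 (fun u v => curve_val u = v)) => // x u v _ <-. Qed.

Lemma curve_graded : is_graded_module (Acurve R Gamma).
Proof.
apply: (@graded_of_weights _ _ e _ 0).
- move=> i; split; first by exists 0; rewrite scale0r.
  by move=> f g [c fc] [c' gc]; exists (c - c'); rewrite scalerBl -fc -gc.
- move=> f; have [s [us fE]] := laurent_monomials (curve_val f).
  have comp i : exists g : curve R Gamma, curve_val g = coefT (curve_val f) i *: monomT R i.
    have hg : coefT (curve_val f) i *: monomT R i \in curveT Gamma.
      have [->|fi] := pselect (coefT (curve_val f) i = 0).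
        by rewrite scale0r; exact: rpred0.
      have /monspanP := valP f => /(_ i fi)[n Gn ->].
      by apply: rpredZ; exact: monomT_monspan.
    by exists (Curve hg).
  have [g gE] := choice comp; exists [seq g i | i <- s]; split.
    by move=> _ /mapP[i _ ->]; exists i; eexists; exact: gE.
  apply: val_inj; rewrite /= big_map curve_val_sum fE.
  by apply: eq_bigr => i _; rewrite gE.
- move=> i j r f /homTP[p rp] [c fc]; exists (c * p.[j%:~R]).
  rewrite -[LHS]/(sa_val r (curve_val f)) rp fc endT_scale op_monomT scalerA.
  by rewrite [j + i]addrC.
- by move=> i f /curve_weight; rewrite add0r.
Qed.

Lemma curve_one_proof : monomT R 0 \in curveT Gamma.
Proof. by apply: (monomT_monspan _ (n := 0)); exact: ns_zero. Qed.
Definition curve_one : Acurve R Gamma := Curve curve_one_proof.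

Lemma curve_one_hom : gm_hom 0 curve_one.
Proof. by exists 1; rewrite scale1r. Qed.

Lemma curve_one_neq0 : curve_one <> 0.
Proof.
move/(congr1 (fun f : curve R Gamma => coefT (curve_val f) 0)).
rewrite -[LHS]/((0 == 0 :> int)%:R : k) -[RHS]/(0 : k) eqxx.
by move/eqP; rewrite oner_eq0.
Qed.

Lemma curve_simple : simple_graded (Acurve R Gamma).
Proof.
apply: simple_of_transitive; first exact: curve_graded.
  by exists curve_one; exact: curve_one_neq0.
move=> i j f g hf f0 hg; have [->|g0] := pselect (g = 0).
  by exists 0; rewrite scale0r.
have [n Gn iE] := curve_hom_in hf f0; have [m Gm jE] := curve_hom_in hg g0.
have [p [ap pi]] : exists p, admissible Gamma G (j - i) p /\ p.[i%:~R] <> 0.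
  apply: admissible_nonroot => l Gl hl il; apply: hl; exists m => //.
  have : i = l%:Z by apply/eqP; rewrite -(eqr_int k) il -pmulrn.
  by move=> <-; rewrite -jE addrC subrK.
have [r rp] := op_DiffA ap; case: hf hg => [c fc] [c' gc].
have c0 : c <> 0.
  by move=> c0; apply: f0; apply: val_inj; rewrite -[LHS]/(curve_val f) fc c0 scale0r.
exists ((c' / (c * p.[i%:~R])) *: r); apply: val_inj.
rewrite -[LHS]/((c' / (c * p.[i%:~R])) *: sa_val r (curve_val f)) -[RHS]/(curve_val g).
rewrite rp fc gc endT_scale op_monomT !scalerA -mulrA divfK; first by rewrite addrC subrK.
by rewrite mulf_neq0 //; exact/eqP.
Qed.

(** ** The cyclic modules generated by a non-integral weight *)

Lemma diagonal_coef (P : endT R) : P \in sa_pred (sDiffT R) ->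
  exists p, forall n : int, coefT (P (monomT R n)) n = p.[n%:~R].
Proof.
move=> /sum_op_gen[u ->]; exists (\sum_(x <- u) (x.1 == 0)%:R *: x.2) => n.
rewrite endT_sum coefT_sum horner_sum; apply: eq_bigr => x _.
by rewrite op_monom hornerZ -[X in X == _]addr0 (inj_eq (addrI n)) eq_sym.
Qed.

(** If [1 = P (E - a)], then the degree zero part [p(E)] of [P] satisfies
    [p(n) (n - a) = 1] for every [n], whence [p (X - a) = 1]. *)
Lemma one_notin_left_ideal (P : endT R) a : P \in sa_pred (sDiffT R) ->
  1 <> P * (eulerT R - a *: 1).
Proof.
move=> hP h; have [p hp] := diagonal_coef hP.
have : 1 = p * ('X - a%:P).
  apply: poly_eq_on_nat => n; rewrite hornerC hornerM hornerXsubC.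
  have : coefT ((1 : endT R) (monomT R n)) n = 1 by rewrite /= eqxx.
  rewrite h endTM.
  have -> : (eulerT R - a *: 1) (monomT R n) = (n%:R - a) *: monomT R n.
    rewrite -[LHS]/(eulerT R (monomT R n) - a *: monomT R n) euler_monomT.
    by rewrite scalerBl -pmulrn.
  by rewrite endT_scale coefTZ hp mulrC -pmulrn => ->.
move/(congr1 (horner^~ a)); rewrite hornerC hornerM hornerXsubC subrr mulr0.
by move/eqP; rewrite oner_eq0.
Qed.

Lemma op_euler_sub d q a :
  op d (q * ('X - a%:P)) = op d q * (eulerT R - a *: 1).
Proof.
apply: endT_eq => f; apply: laurentP => i; rewrite endTM !coef_op.
rewrite -[X in _ = _ * X]/(coefT (eulerT R f) (i - d) - a * coefT f (i - d)).
by rewrite coef_euler -mulrBl mulrA hornerM hornerXsubC.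
Qed.

Section DmodE.
Variable alpha : k.
Local Notation M := (DmodE Gamma alpha).
Hypothesis alpha_nonint : forall z : int, alpha <> z%:~R.

Definition DmodE_one : M := cyclic_pi (e - alpha *: (1 : D)) 1.

Lemma DmodE_gen (x : M) : exists r : D, x = r *: DmodE_one.
Proof. by have [r ->] := cyclic_pi_surj x; exists r; exact: cyclic_piE. Qed.

Lemma DmodE_hom d (x : M) : gm_hom d x <->
  exists2 r : D, homT d (sa_val r) & x = r *: DmodE_one.
Proof. by split=> -[r hr ->]; exists r => //; rewrite cyclic_piE. Qed.

Lemma DmodE_one_weight : weight e alpha DmodE_one.
Proof.
apply/eqP; rewrite -subr_eq0; apply/eqP.
by rewrite /kscale -scalerBl; exact: cyclic_ann.
Qed.

Lemma DmodE_one_neq0 : DmodE_one <> 0.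
Proof.
move=> /cyclic_pi_eq0[b /(congr1 (@sa_val _ _))].
by apply: one_notin_left_ideal; exact: DiffA_DiffT.
Qed.

(** Write [p = q (X - alpha)]. As [alpha] is not an integer, [q] vanishes at the
    same integers as [p], so that [t^d q(E)] is still in [D]. *)
Lemma DmodE_act0 r d p : sa_val r = op d p -> p.[alpha] = 0 -> r *: DmodE_one = 0.
Proof.
move=> rp /eqP; rewrite -rootE => /factor_theorem[q qE].
have [|b bq] := @op_DiffA R Gamma d q.
  move=> n Gn hn; have := DiffA_admissible rp Gn hn.
  rewrite qE hornerM hornerXsubC => /eqP; rewrite mulf_eq0 => /orP[/eqP//|].
  rewrite subr_eq0 => /eqP na; case: (alpha_nonint (z := n)).
  by rewrite -na pmulrn.
rewrite -cyclic_piE; apply/cyclic_pi_eq0; exists b; apply: val_inj => /=.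
rewrite rp qE -[RHS]/(sa_val b * (eulerT R - alpha *: 1)) bq.
exact: op_euler_sub.
Qed.

Lemma DmodE_graded : is_graded_module M.
Proof.
apply: (@graded_of_weights _ _ e _ alpha).
- move=> d; split.
    by apply/DmodE_hom; exists 0; [exact: homT0|rewrite scale0r].
  move=> x y /DmodE_hom[r hr ->] /DmodE_hom[s hs ->]; apply/DmodE_hom.
  by exists (r - s); [exact: homTB|rewrite scalerBl].
- move=> x; have [r ->] := DmodE_gen x; have [s [c [us hc ->]]] := DiffA_graded r.
  exists [seq c i *: DmodE_one | i <- s]; rewrite big_map scaler_suml; split=> //.
  by move=> _ /mapP[i _ ->]; exists i; apply/DmodE_hom; exists (c i).
- move=> i j r x hr /DmodE_hom[s hs ->]; apply/DmodE_hom; exists (r * s).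
    have [p rp] := (homTP _ _).1 hr; have [q sq] := (homTP _ _).1 hs.
    by apply/homTP; rewrite -[sa_val _]/(sa_val r * sa_val s) rp sq op_mul; eexists.
  by rewrite scalerA.
- by move=> i x /DmodE_hom[r hr ->]; apply: op_weight => //; exact: DmodE_one_weight.
Qed.

Lemma DmodE_simple : simple_graded M.
Proof.
apply: simple_of_transitive; first exact: DmodE_graded.
  by exists DmodE_one; exact: DmodE_one_neq0.
move=> i j x y /DmodE_hom[r /homTP[p rp] ->] x0 /DmodE_hom[s /homTP[q sq] ->].
have pa : p.[alpha] != 0 by apply/eqP => pa; apply: x0; exact: DmodE_act0 rp pa.
have [g [ag ga]] : exists g, admissible Gamma G (j - i) g /\ g.[alpha + i%:~R] <> 0.
  apply: admissible_nonroot => n Gn hn wn; apply: (alpha_nonint (z := n%:Z - i)).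
  by rewrite rmorphB /= -pmulrn -wn addrK.
have [t tg] := op_DiffA ag; pose c := q.[alpha] / (g.[alpha + i%:~R] * p.[alpha]).
exists (c *: t); rewrite scalerA; apply/eqP; rewrite -subr_eq0 -scalerBl; apply/eqP.
apply: (@DmodE_act0 _ j (c *: ((g \Po ('X + (i%:~R)%:P)) * p) - q)).
  rewrite -[LHS]/(c *: sa_val t * sa_val r - sa_val s) tg rp sq -scalerAl op_mul.
  by rewrite subrK opB opZ.
rewrite hornerD hornerN hornerZ hornerM horner_shift /c divfK ?subrr //.
by rewrite mulf_neq0 //; exact/eqP.
Qed.

Lemma DmodE_one_hom : gm_hom 0 DmodE_one.
Proof.
by apply/DmodE_hom; exists 1; [exact: homT1|rewrite scale1r].
Qed.

End DmodE.

End Models.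

(** * Tensor products *)

Section TensorLemmas.
Variables (L Q : nzRingType) (P : bimodule L Q) (M : lmodType Q).

Lemma tensDl (p p' : P) (m : M) : tens (p + p') m = tens p m + tens p' m.
Proof. by case: (tens_balanced P M). Qed.
Lemma tensDr (p : P) (m m' : M) : tens p (m + m') = tens p m + tens p m'.
Proof. by case: (tens_balanced P M). Qed.
Lemma tens_ract (p : P) q (m : M) : tens (ract p q) m = tens p (q *: m).
Proof. by case: (tens_balanced P M). Qed.
Lemma tens0l (m : M) : tens (0 : P) m = 0.
Proof. by rewrite -(scale0r (0 : P)) -tensZ scale0r. Qed.
Lemma tens0r (p : P) : tens p (0 : M) = 0.
Proof. by apply: (addrI (tens p 0)); rewrite -tensDr !addr0. Qed.
Lemma tensNl (p : P) (m : M) : tens (- p) m = - tens p m.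
Proof. by rewrite -scaleN1r -tensZ scaleN1r. Qed.
Lemma tens_suml I (s : seq I) (F : I -> P) (m : M) :
  tens (\sum_(x <- s) F x) m = \sum_(x <- s) tens (F x) m.
Proof.
by apply: (big_rec2 (fun p t => tens p m = t)); [exact: tens0l|move=> x p t _ <-; exact: tensDl].
Qed.
End TensorLemmas.

(** * The module at infinity *)

Section Minf.
Variables (R : realType) (Gamma : numerical_semigroup).
Local Notation k := R[i].
Local Notation D := (sa_type (sDiffA R Gamma)).
Local Notation e := (eulerA R Gamma).
Local Notation G := (ns_set Gamma).
Local Notation M := (Minf R Gamma).
Local Notation B := (DBA_bimod R Gamma).
Implicit Types (r : D) (p q : {poly k}) (P Q : B).

Let eE : sa_val e = eulerT R. Proof. by []. Qed.

Lemma DBA_inj P Q : DBA_val P = DBA_val Q -> P = Q.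
Proof. exact: val_inj. Qed.

Lemma op_DBA d p : admissible Gamma setT d p -> exists P : B, DBA_val P = op d p.
Proof.
move=> /op_preserves h; have hr : op d p \in DBA_pred Gamma.
  by apply/DBA_predP; split=> //; exact: op_DiffT.
by exists (MkDBA hr).
Qed.

Lemma DBA_preserves P : preserves Gamma setT (DBA_val P).
Proof. by case: P => P /= /DBA_predP[_]. Qed.

Lemma DBA_admissible P d p : DBA_val P = op d p -> admissible Gamma setT d p.
Proof. by move=> Pp; apply/op_preserves; rewrite -Pp; exact: DBA_preserves. Qed.

Lemma DBA_val_sum I (s : seq I) (F : I -> B) :
  DBA_val (\sum_(x <- s) F x : B) = \sum_(x <- s) DBA_val (F x).
Proof. by apply: (big_rec2 (fun (u : B) v => DBA_val u = v)) => // x u v _ <-. Qed.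

Lemma DBA_graded P : exists (s : seq int) (c : int -> B),
  (forall i, homT i (DBA_val (c i))) /\ P = \sum_(i <- s) c i.
Proof.
have hP : DBA_val P \in sa_pred (sDiffT R) by case: P => P /= /DBA_predP[].
have [s [pc [us PE]]] := sum_op hP.
have comp i : exists c : B, DBA_val c = op i (if i \in s then pc i else 0).
  apply: op_DBA; case: ifP => [si|_]; last by move=> *; rewrite horner0.
  by apply/op_preserves; apply: (sum_op_preserves us) si; rewrite -PE; exact: DBA_preserves.
have [c hc] := choice comp.
exists s, c; split=> //; first by move=> i; apply/homTP; rewrite hc; eexists.
apply: DBA_inj; rewrite DBA_val_sum PE; apply: eq_big_seq => i si.
by rewrite hc si.
Qed.

Definition delta : gr_cyclic (tWeyl R) := cyclic_pi (tWeyl R) 1.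

(** The image of [P] in [D(B, A) / D(B, A) t], which is the module at infinity.
    *)
Definition Minf_class P : M := tens P delta.

Lemma Minf_classD P Q : Minf_class (P + Q) = Minf_class P + Minf_class Q. Proof. exact: tensDl. Qed.
Lemma Minf_class0 : Minf_class 0 = 0. Proof. exact: tens0l. Qed.
Lemma Minf_classN P : Minf_class (- P) = - Minf_class P. Proof. exact: tensNl. Qed.
Lemma Minf_classZ r P : r *: Minf_class P = Minf_class (r *: P). Proof. exact: tensZ. Qed.

Lemma tens_pi P (q : sa_type (sWeyl R)) : tens P (cyclic_pi (tWeyl R) q) = Minf_class (ract P q).
Proof. by rewrite cyclic_piE -tens_ract. Qed.

Lemma Minf_hom i (z : M) : gm_hom i z <-> exists P, homT i (DBA_val P) /\ z = Minf_class P.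
Proof.
split=> [[u [hu ->]]|[P [hP ->]]].
  rewrite big_seq; apply: (big_ind (fun z => exists P, homT i (DBA_val P) /\ z = Minf_class P)).
  - by exists 0; rewrite Minf_class0; split=> //; exact: homT0.
  - move=> _ _ [P [hP ->]] [Q [hQ ->]]; exists (P + Q); rewrite Minf_classD; split=> //.
    exact: homTD.
  - move=> [P m] /hu[j [l [/= hP [q hq ->] <-]]]; exists (ract P q).
    by split; [exact: homT_mul|exact: tens_pi].
exists [:: (P, delta)]; rewrite big_seq1; split=> // y; rewrite inE => /eqP -> /=.
exists i, 0; rewrite addr0; split=> //; by exists 1; first exact: homT1.
Qed.

(** One has [t^d p(E) = Q t] with [Q = t^(d - 1) p(E - 1)], and [t] kills the
    generator. For [Q] to map polynomials into the algebra, the only condition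
    not inherited from [P] is that [Q 1 = p(-1) t^(d - 1)] be in the algebra. *)
Lemma Minf_class_eq0 P d p : DBA_val P = op d p -> p.[-1] = 0 \/ in_semigroup Gamma (d - 1) ->
  Minf_class P = 0.
Proof.
move=> Pp h; have [|Q Qq] := @op_DBA (d - 1) (p \Po ('X + ((-1)%:~R)%:P)).
  move=> [|n] _ hn; rewrite horner_shift.
    rewrite add0r; case: h => [<-|h]; first by rewrite rmorphN1.
    by case: hn; rewrite add0r.
  have -> : n.+1%:R + (-1)%:~R = n%:R :> k by rewrite rmorphN1 -natr1 addrK.
  apply: (DBA_admissible Pp) => // -[m Gm hm]; apply: hn; exists m => //; lia.
have -> : P = ract Q (tWeyl R).
  apply: DBA_inj; rewrite Pp -[RHS]/(DBA_val Q * tpow R 1) Qq tpow_op op_mul mulr1.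
  rewrite subrK -comp_polyA comp_polyD comp_polyX comp_polyC -addrA -polyCD.
  by rewrite -intrD addrN polyC0 addr0 comp_polyXr.
rewrite /Minf_class tens_ract.
have -> : tWeyl R *: delta = 0 by exact: cyclic_ann.
exact: tens0r.
Qed.

Lemma Minf_weight i (z : M) : gm_hom i z -> weight e (-1 + i%:~R) z.
Proof.
move=> /Minf_hom[P [/homTP[p Pp] ->]]; apply/eqP; rewrite -subr_eq0; apply/eqP.
rewrite /kscale !Minf_classZ -Minf_classN -Minf_classD.
apply: (@Minf_class_eq0 _ i (('X + 1) * p)); last by left; rewrite hornerM !hornerE addNr mul0r.
rewrite -[LHS]/(eulerT R * DBA_val P - ((-1 + i%:~R) *: 1) * DBA_val P) Pp euler_op.
rewrite op_mul add0r comp_polyX.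
apply: endT_eq => f; apply: laurentP => j; rewrite !coef_op.
rewrite -[LHS]/(coefT (op i (('X + i%:~R%:P) * p) f) j - (-1 + i%:~R) * coefT (op i p f) j).
by rewrite !coef_op !(hornerM, hornerD, hornerX, hornerC); ring.
Qed.

(** This functional shows that the module is not zero. It is compatible with the
    relation [Q t = 0] because [P Q t t^-1 = P Q 1] lies in the algebra of
    [Gamma], where [t^-1] does not occur. *)
Lemma residue : exists f : M -> k, {morph f : x y / x + y} /\
  forall P, f (Minf_class P) = coefT (DBA_val P (monomT R (-1))) (-1).
Proof.
pose b (P : B) (m : gr_cyclic (tWeyl R)) : k :=
  coefT (DBA_val P (sa_val (repr (m : Quotient.quot _)) (monomT R (-1)))) (-1).
have bE P (q : sa_type (sWeyl R)) :
    b P (cyclic_pi (tWeyl R) q) = coefT (DBA_val P (sa_val q (monomT R (-1)))) (-1).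
  rewrite /b; set q' := repr _.
  have /cyclic_piP[s qs] : cyclic_pi (tWeyl R) q' == cyclic_pi (tWeyl R) q.
    by rewrite /cyclic_pi reprK.
  have qE : q' = q + s * tWeyl R by rewrite -qs addrC subrK.
  rewrite qE -[sa_val (q + _)]/(sa_val q + sa_val s * tpow R 1) endTD endTM.
  have -> : tpow R 1 (monomT R (-1)) = monomT R 0.
    by apply: laurentP => i; rewrite tpow_op op_monomT hornerC scale1r.
  have hs : sa_val s (monomT R 0) \in (@polyT R).
    by apply: Weyl_polyT; [exact: valP|exact: (monomT_monspan _ (n := 0))].
  have /monspanP hP := DBA_preserves P hs.
  rewrite -[X in DBA_val P (X + _)]scale1r endT_linear scale1r coefTD.
  have [->|/hP[n]//] := pselect (coefT (DBA_val P (sa_val s (monomT R 0))) (-1) = 0).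
  by rewrite addr0.
have hb : balanced b.
  split=> [P Q m|P m m'|P q m].
  - by [].
  - have [q ->] := cyclic_pi_surj m; have [q' ->] := cyclic_pi_surj m'.
    rewrite -cyclic_piD !bE -[sa_val (q + q')]/(sa_val q + sa_val q') endTD.
    by rewrite -[X in DBA_val P (X + _)]scale1r endT_linear scale1r.
  - have [q' ->] := cyclic_pi_surj m.
    have -> : q *: cyclic_pi (tWeyl R) q' = cyclic_pi (tWeyl R) (q * q').
      by rewrite -cyclic_scaleE.
    by rewrite !bE.
have [f [fD fE]] := tensor_universal hb; exists f; split=> // P.
by rewrite /Minf_class fE bE.
Qed.

Lemma Minf_generator : exists P, gm_hom 0 (Minf_class P) /\ Minf_class P <> 0.
Proof.
have [p [ap pw]] : exists p : {poly k}, admissible Gamma setT 0 p /\ p.[-1] <> 0.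
  apply: admissible_nonroot => n _ _ /eqP.
  by rewrite eq_sym -subr_eq0 opprK natr1 pnatr_eq0.
have [P Pp] := op_DBA ap; exists P; split.
  by apply/Minf_hom; exists P; split=> //; apply/homTP; exists p.
have [f [fD fE]] := residue; move=> P0; apply: pw.
have f0 : f 0 = 0 by apply: (addrI (f 0)); rewrite -fD !addr0.
by rewrite -f0 -P0 fE Pp op_monom addr0 eqxx mul1r rmorphN1.
Qed.

Lemma Minf_graded : is_graded_module M.
Proof.
apply: (@graded_of_weights _ _ e _ (-1)).
- move=> i; split; first by apply/Minf_hom; exists 0; rewrite Minf_class0; split=> //; exact: homT0.
  move=> _ _ /Minf_hom[P [hP ->]] /Minf_hom[Q [hQ ->]]; apply/Minf_hom; exists (P - Q).
  by rewrite Minf_classD Minf_classN; split=> //; exact: homTB.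
- move=> x; have [u ->] := tensor_span x.
  apply: (big_ind (fun x : M => exists u : seq M,
    (forall y, y \in u -> exists i, gm_hom i y) /\ x = \sum_(y <- u) y)).
  + by exists [::]; rewrite big_nil.
  + move=> _ _ [v [hv ->]] [v' [hv' ->]]; exists (v ++ v'); rewrite big_cat; split=> //.
    by move=> y; rewrite mem_cat => /orP[/hv|/hv'].
  + move=> [P m] _ /=; have [q ->] := cyclic_pi_surj m; rewrite tens_pi.
    have [s [c [hc ->]]] := DBA_graded (ract P q).
    exists [seq Minf_class (c i) | i <- s]; rewrite big_map; split.
      by move=> _ /mapP[i _ ->]; exists i; apply/Minf_hom; exists (c i).
    exact: tens_suml.
- move=> i j r _ hr /Minf_hom[P [hP ->]]; apply/Minf_hom; exists (r *: P).
  by rewrite Minf_classZ; split=> //; exact: homT_mul.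
- exact: Minf_weight.
Qed.

Lemma Minf_simple : simple_graded M.
Proof.
apply: simple_of_transitive; first exact: Minf_graded.
  by have [P [_ P0]] := Minf_generator; exists (Minf_class P).
move=> i j _ _ /Minf_hom[P [/homTP[p Pp] ->]] P0 /Minf_hom[Q [/homTP[q Qq] ->]].
have pw : p.[-1] != 0 by apply/eqP => pw; apply: P0; apply: (Minf_class_eq0 Pp); left.
have iG : ~ in_semigroup Gamma (i - 1) by move=> iG; apply: P0; apply: (Minf_class_eq0 Pp); right.
have [g [ag gw]] : exists g : {poly k}, admissible Gamma G (j - i) g /\ g.[-1 + i%:~R] <> 0.
  apply: admissible_nonroot => n Gn _ wn; apply: iG; exists n => //; apply/eqP.
  by rewrite -(eqr_int k) rmorphB rmorph1 addrC wn -pmulrn.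
have [t tg] := op_DiffA ag; pose c := q.[-1] / (g.[-1 + i%:~R] * p.[-1]).
exists (c *: t); rewrite Minf_classZ; apply/eqP; rewrite -subr_eq0 -Minf_classN -Minf_classD; apply/eqP.
apply: (@Minf_class_eq0 _ j (c *: ((g \Po ('X + (i%:~R)%:P)) * p) - q)).
  rewrite -[LHS]/(c *: sa_val t * DBA_val P - DBA_val Q) tg Pp Qq -scalerAl op_mul.
  by rewrite subrK opB opZ.
left; rewrite hornerD hornerN hornerZ hornerM horner_shift /c divfK ?subrr //.
by rewrite mulf_neq0 //; exact/eqP.
Qed.

Lemma Minf_has_weight : has_weight M (-1).
Proof.
have [P [hP P0]] := Minf_generator; exists 0, (Minf_class P); split=> //.
by have := Minf_weight hP; rewrite addr0.
Qed.

End Minf.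

(** * Localization *)

Section Localization.
Variables (R : realType) (Gamma : numerical_semigroup).
Local Notation k := R[i].
Local Notation D := (sa_type (sDiffA R Gamma)).
Local Notation DT := (sa_type (sDiffT R)).
Local Notation e := (eulerA R Gamma).
Local Notation eT := (eulerDiffT R).
Local Notation G := (ns_set Gamma).
Implicit Types (r : D) (P Q : DT) (p q : {poly k}).

Let eE : sa_val e = eulerT R. Proof. by []. Qed.

Section Module.
Variable M : grMod (DiffA R Gamma).
Local Notation loc := (localize M).

Definition fraction P (m : M) : loc := @tens _ _ (DiffT_bimod R Gamma) M P m.

Lemma fractionZ P Q m : P *: fraction Q m = fraction (P * Q) m.
Proof. exact: tensZ. Qed.

Lemma fraction_scale P r m : fraction P (r *: m) = fraction (P * inclA r) m.
Proof. by rewrite /fraction -tens_ract. Qed.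

Lemma fraction_kscale c P m : fraction P (kscale c m : M) = kscale c (fraction P m).
Proof.
rewrite /kscale fraction_scale fractionZ; congr fraction; apply: val_inj.
rewrite -[LHS]/(sa_val P * (c *: 1)) -[RHS]/((c *: 1) * sa_val P).
by rewrite -scalerAr mulr1 -scalerAl mul1r.
Qed.

Lemma fraction_weight d P (m : M) w : homT d (sa_val P) -> weight e w m ->
  weight eT (w + d%:~R) (fraction P m).
Proof.
move=> hP wm; have w1 : weight eT w (fraction 1 m).
  rewrite /weight fractionZ mulr1 -fraction_kscale -wm fraction_scale; congr fraction.
  by rewrite mul1r; apply: val_inj.
by rewrite -[P]mulr1 -fractionZ; exact: op_weight.
Qed.

Hypothesis sM : simple_graded M.

Section Weight.
Variables (i : int) (x : M) (w : k).
Hypotheses (hx : gm_hom i x) (x0 : x <> 0) (wx : weight e w x).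

Lemma localize_weight j (z : loc) : gm_hom j z -> weight eT (w + (j - i)%:~R) z.
Proof.
case=> u [hu ->]; rewrite big_seq; apply: big_ind.
- exact: weight0.
- by move=> a b; exact: weightD.
move=> [P m] /hu[d [l [/= hP hm <-]]].
have -> : w + (d + l - i)%:~R = w + (l - i)%:~R + d%:~R.
  by rewrite -[RHS]addrA -intrD; congr (_ + _%:~R); lia.
by apply: fraction_weight => //; exact: (simple_weight eE (@DiffA_graded _ _) sM hx x0 wx hm).
Qed.

(** If [n] is large, [t^n] is in [D] and sends a given homogeneous [m] to a vector
    whose weight is in [Gamma]. This vector vanishes, since [w], a weight of
    the same simple module, is not in [Gamma]; so [P m = P t^(- n) t^n m = 0]. *)
Lemma localize_zero (z : int) : w = z%:~R -> ~ semigroup_weight Gamma w ->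
  forall j (y : loc), gm_hom j y -> y = 0.
Proof.
move=> wz nw j y [u [hu ->]]; apply: big1_seq => -[P m] /andP[_ /hu[d [l [/= hP hm _]]]].
have [c hc] := semigroup_conductor Gamma.
pose n := (c + absz (z + (l - i))%R)%N.
have [|r rn] := @op_DiffA R Gamma n%:Z 1.
  move=> n' Gn' []; exists (n' + n)%N => //; apply: ns_add => //; apply: hc; lia.
have rm0 : r *: m = 0.
  apply: contrapT => rm; have hrm : gm_hom (n%:Z + l) (r *: m).
    by case: sM => [[_ h]] _ _; apply: h => //; apply/homTP; exists 1.
  have wrm := simple_weight eE (@DiffA_graded _ _) sM hx x0 wx hrm.
  have := simple_semigroup_weight sM hrm rm wrm hx x0.
  rewrite wz -!intrD.
  have -> : z + (n%:Z + l - i) + (i - (n%:Z + l)) = z by lia.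
  rewrite -wz => h; apply/nw/h/semigroup_weight_int.
  by exists (absz (z + (n%:Z + l - i))); [apply: hc|]; lia.
have hT : op (- n%:Z) 1 \in sa_pred (sDiffT R) by exact: op_DiffT.
have PE : P = P * @SaElt _ (sDiffT R) _ hT * inclA r.
  apply: val_inj; rewrite -[RHS]/(sa_val P * op (- n%:Z) 1 * sa_val r) rn -mulrA.
  by rewrite op_mul mulr1 addNr -polyC1 comp_polyC polyC1 -one_op mulr1.
by rewrite -[LHS]/(fraction P m) PE -fraction_scale rm0; exact: tens0r.
Qed.

(** The map [P |-> P x] factors through [N_w], and is onto because [M] is
    generated by [x]. If it kills [P], it kills each component [t^d p(E)] of
    [P], whose image is [p(w) t^d x]. Now [t^d x <> 0], because [t^d] is
    invertible and [x <> 0] in the localization. Hence [p(w) = 0], and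
    [t^d p(E)] is a multiple of [E - w]. *)
Lemma localize_iso : i = 0 -> fraction 1 x <> 0 -> gr_iso loc (Nmod w).
Proof.
move=> i0 fx0; apply: gr_iso_sym.
pose a : DT := eT - w *: (1 : DT).
have ann Q : fraction (Q * a) x = 0.
  have -> : Q * a = Q * inclA (e - w *: (1 : D)) by congr (_ * _); apply: val_inj.
  rewrite -fraction_scale.
  have -> : (e - w *: (1 : D)) *: x = 0 by rewrite scalerBl wx /kscale subrr.
  exact: tens0r.
pose F (z : Nmod w) : loc := fraction (repr (z : Quotient.quot _)) x.
have FE P : F (cyclic_pi a P) = fraction P x.
  rewrite /F; set Q := repr _.
  have /cyclic_piP[b Qb] : cyclic_pi a Q == cyclic_pi a P by rewrite /cyclic_pi reprK.
  have -> : Q = P + b * a by rewrite -Qb addrC subrK.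
  by rewrite /fraction tensDl -/(fraction P x) -/(fraction _ x) ann addr0.
have lin : linear F.
  move=> P y z; have [y' ->] := cyclic_pi_surj y; have [z' ->] := cyclic_pi_surj z.
  have -> : P *: cyclic_pi a y' + cyclic_pi a z' = cyclic_pi a (P * y' + z').
    by rewrite cyclic_piD -cyclic_scaleE.
  by rewrite !FE fractionZ /fraction tensDl.
have Fker z : F z = 0 -> z = 0.
  have [P ->] := cyclic_pi_surj z; rewrite FE => Px0.
  have [s [pc [us PE]]] := sum_op (valP P).
  have [c hc] : exists c : int -> DT, forall d, sa_val (c d) = op d (pc d).
    by exists (fun d => SaElt (op_DiffT d (pc d))).
  have PcE : P = \sum_(d <- s) c d.
    by apply: val_inj; rewrite /= sa_val_sum PE; apply: eq_bigr => d _; rewrite hc.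
  have c0 d : d \in s -> fraction (c d) x = 0.
    apply: (weight_independent (e := eT) (w := w) us (c := fun d => fraction (c d) x)).
      by move=> l; apply: fraction_weight => //; apply/homTP; rewrite hc; eexists.
    by rewrite -[RHS]Px0 PcE /fraction tens_suml.
  rewrite PcE.
  have cyc_sum : cyclic_pi a (\sum_(d <- s) c d) = \sum_(d <- s) cyclic_pi a (c d).
    rewrite cyclic_piE scaler_suml; apply: eq_bigr => d _; exact: esym (cyclic_piE _ _).
  rewrite cyc_sum; apply: big1_seq => d /andP[_ /c0 cd0].
  have pw : (pc d).[w] = 0.
    have t0 (n : int) : op n 1 \in sa_pred (sDiffT R) by exact: op_DiffT.
    have [|r rE] := @op_DiffA R Gamma 0 (pc d).
      by move=> n Gn; rewrite addr0 => -[]; exists n.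
    have cE : c d = SaElt (t0 d) * inclA r.
      apply: val_inj; rewrite -[LHS]/(sa_val (c d)) hc -[RHS]/(op d 1 * sa_val r) rE op_mul addr0.
      by rewrite -polyC1 comp_polyC polyC1 mul1r.
    move: cd0; rewrite cE -fraction_scale (op0_act eE rE wx) fraction_kscale.
    case/kscale_eq0 => // td0; case: fx0.
    have -> : 1 = SaElt (t0 (- d)) * SaElt (t0 d).
      apply: val_inj; rewrite -[RHS]/(op (- d) 1 * op d 1) op_mul addNr.
      by rewrite -polyC1 comp_polyC polyC1 mulr1 -one_op.
    by rewrite -fractionZ td0 scaler0.
  move/eqP: pw; rewrite -rootE => /factor_theorem[q qE].
  apply/cyclic_pi_eq0; exists (SaElt (op_DiffT d q)); apply: val_inj.
  rewrite /= hc qE -[RHS]/(op d q * (eulerT R - w *: 1)); exact: op_euler_sub.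
have Finj : injective F.
  move=> y z Fyz; apply/eqP; rewrite -subr_eq0; apply/eqP/Fker.
  pose FL : {linear Nmod w -> loc} := HB.pack F (GRing.isLinear.Build _ _ _ _ F lin).
  by rewrite -[F]/(FL : _ -> _) linearB /= Fyz subrr.
have reduce P (m : M) l d : homT d (sa_val P) -> gm_hom l m -> exists Q,
    homT (d + l) (sa_val Q) /\ fraction P m = fraction Q x.
  move=> hP hm; have [r [hr <-]] := simple_transitive (@DiffA_graded _ _) sM hx x0 hm.
  exists (P * inclA r); rewrite fraction_scale; split=> //.
  by apply: homT_mul => //; move: hr; rewrite i0 subr0.
have Fsurj z : exists y, F y = z.
  have [u ->] := tensor_span z; apply: (big_ind (fun z : loc => exists y, F y = z)).
  - by exists (cyclic_pi a 0); rewrite FE; exact: tens0l.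
  - move=> _ _ [y <-] [y' <-]; have [b ->] := cyclic_pi_surj y.
    have [b' ->] := cyclic_pi_surj y'; exists (cyclic_pi a (b + b')).
    by rewrite !FE; exact: tensDl.
  - move=> [P m] _; have [r <-] := simple_cyclic (@DiffA_graded _ _) sM m hx x0.
    by exists (cyclic_pi a (P * inclA r)); rewrite FE -fraction_scale.
pose FL : {linear Nmod w -> loc} := HB.pack F (GRing.isLinear.Build _ _ _ _ F lin).
have [g gK] := choice Fsurj.
exists FL; split; first by exists g => [y|z]; [apply: Finj|]; rewrite /= gK.
move=> j z; split.
  move=> [P hP ->]; rewrite [FL _]FE; exists [:: (P, x)]; rewrite big_seq1; split=> // y.
  by rewrite inE => /eqP->; exists j, 0; rewrite addr0; split=> //; rewrite -i0.
have [P ->] := cyclic_pi_surj z; rewrite [FL _]FE => -[u [hu Pu]].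
have [Q [hQ PQ]] : exists Q, homT j (sa_val Q) /\ fraction P x = fraction Q x.
  rewrite Pu big_seq; apply: (big_ind (fun z : loc => exists Q,
    homT j (sa_val Q) /\ z = fraction Q x)).
  - by exists 0; split; [exact: homT0|exact: esym (tens0l _ _)].
  - move=> _ _ [Q [hQ ->]] [Q' [hQ' ->]]; exists (Q + Q').
    by split; [exact: homTD|exact: esym (tensDl _ _ _)].
  - by move=> [Q m] /hu[d [l [hQ hm <-]]]; exact: reduce.
exists Q => //; apply: Finj; rewrite !FE; exact: PQ.
Qed.
End Weight.
End Module.
End Localization.

(** * Classification *)

Section Classification.
Variables (R : realType) (Gamma : numerical_semigroup).
Local Notation k := R[i].
Local Notation DT := (sa_type (sDiffT R)).
Local Notation e := (eulerA R Gamma).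
Local Notation eT := (eulerDiffT R).
Local Notation G := (ns_set Gamma).
Implicit Types (M X : grMod (DiffA R Gamma)) (alpha w : k).

Let eE : sa_val e = eulerT R. Proof. by []. Qed.

Definition standard alpha : grMod (DiffA R Gamma) :=
  if alpha == 0 then Acurve R Gamma else DmodE Gamma alpha.

Definition index alpha := Jstar alpha \/ alpha = 0.

Lemma Re_int (z : int) : complex.Re (z%:~R : k) = z%:~R.
Proof.
have -> : (z%:~R : k) = (z%:~R)%:C by rewrite rmorph_int.
by [].
Qed.

Lemma Re_add w w' : complex.Re (w + w') = complex.Re w + complex.Re w'.
Proof. by case: w => ? ?; case: w'. Qed.

Lemma index_Re alpha : index alpha -> 0 <= complex.Re alpha < 1.
Proof. by case=> [[]//|->]; rewrite /= lexx ltr01. Qed.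

Lemma index_translate alpha beta (z : int) : index alpha -> index beta ->
  beta = alpha + z%:~R -> z = 0.
Proof.
move=> /index_Re/andP[a0 a1] /index_Re/andP[b0 b1] h.
move: b0 b1; rewrite h Re_add Re_int => b0 b1.
have : -1 < z%:~R :> R by lra.
have : z%:~R < 1 :> R by lra.
rewrite -[1]/(1%:~R : R) -rmorphN /= !ltr_int; lia.
Qed.

Lemma Jstar_nonint alpha : Jstar alpha -> forall z : int, alpha <> z%:~R.
Proof.
move=> Ja z az; have := @index_translate 0 alpha z (or_intror erefl) (or_introl Ja).
by rewrite add0r => /(_ az) z0; case: Ja => _; apply; rewrite az z0.
Qed.

Lemma nonint_not_semigroup w : (forall z : int, w <> z%:~R) -> ~ semigroup_weight Gamma w.
Proof. by move=> h [n _ wn]; apply: (h n); rewrite wn pmulrn. Qed.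

Lemma semigroup_weight0 : semigroup_weight Gamma (0 : k).
Proof. by exists 0; first exact: ns_zero. Qed.

(** That the generator [x] survives in the localization is seen by mapping
    [Diff(T) \otimes A] to [T] by [P \otimes f |-> P f], and
    [Diff(T) \otimes D / D (E - alpha)] to [N_alpha]. *)
Lemma standard_spec alpha : index alpha -> simple_graded (standard alpha) /\
  exists x : standard alpha, [/\ gm_hom 0 x, x <> 0, weight e alpha x
    & fraction 1 x <> 0].
Proof.
rewrite /standard; case: eqP => [-> _|a0 [Ja|//]].
  split; first exact: curve_simple.
  exists (curve_one R Gamma); split; [exact: curve_one_hom|exact: curve_one_neq0| |].
    exact: (curve_weight (curve_one_hom R Gamma)).
  pose b (P : DiffT_bimod R Gamma) (f : Acurve R Gamma) : laurent R :=
    sa_val (P : DT) (curve_val f).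
  have hb : balanced b.
    split=> [P Q f|P f g|P Q f] //.
    rewrite /b -[curve_val (f + g)]/(curve_val f + curve_val g).
    by rewrite -[X in sa_val P (X + _)]scale1r endT_linear scale1r.
  have [f [fD fE]] := tensor_universal hb.
  have f0 : f 0 = 0 by apply: (addrI (f 0)); rewrite -fD !addr0.
  move=> /(congr1 f); rewrite f0 fE => h.
  have : coefT (monomT R 0) 0 = coefT (0 : laurent R) 0 by rewrite -h.
  by rewrite coef_monomT eqxx => /eqP; rewrite oner_eq0.
have nz := Jstar_nonint Ja.
split; first exact: DmodE_simple.
exists (DmodE_one Gamma alpha); split; [exact: DmodE_one_hom|exact: DmodE_one_neq0| |].
  exact: DmodE_one_weight.
pose a : DT := eT - alpha *: (1 : DT).
pose b (P : DiffT_bimod R Gamma) (m : DmodE Gamma alpha) : Nmod alpha :=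
  cyclic_pi a ((P : DT) * inclA (repr (m : Quotient.quot _))).
have bE P r : b P (cyclic_pi (e - alpha *: (1 : sa_type (sDiffA R Gamma))) r) =
    cyclic_pi a ((P : DT) * inclA r).
  apply/eqP/cyclic_piP; set r' := repr _.
  have /cyclic_piP[s rs] : cyclic_pi (e - alpha *: (1 : sa_type (sDiffA R Gamma))) r' ==
      cyclic_pi (e - alpha *: (1 : sa_type (sDiffA R Gamma))) r.
    by rewrite /cyclic_pi reprK.
  exists (P * inclA s); rewrite -mulrBr -mulrA; congr (_ * _); apply: val_inj.
  exact: (congr1 (@sa_val _ _) rs).
have hb : balanced b.
  split=> [P Q m|P m m'|P q m].
  - by rewrite /b -cyclic_piD -mulrDl.
  - have [r ->] := cyclic_pi_surj m; have [r' ->] := cyclic_pi_surj m'.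
    rewrite -cyclic_piD !bE -cyclic_piD -mulrDr; congr (cyclic_pi _ (_ * _)).
    exact: val_inj.
  - have [r ->] := cyclic_pi_surj m.
    rewrite bE -[q *: _]/(cyclic_scale q (cyclic_pi _ r)) cyclic_scaleE bE.
    by rewrite -mulrA; congr (cyclic_pi _ (_ * _)); exact: val_inj.
have [f [fD fE]] := tensor_universal hb.
have f0 : f 0 = 0 by apply: (addrI (f 0)); rewrite -fD !addr0.
move=> /(congr1 f); rewrite f0 fE bE => /cyclic_pi_eq0[c /(congr1 (@sa_val _ _)) h].
apply: (one_notin_left_ideal (a := alpha) (valP c)).
by apply: etrans h; exact: endT_eq.
Qed.

Lemma standard_is_Malpha alpha : index alpha -> is_Malpha alpha (standard alpha).
Proof.
move=> /standard_spec[sS [x [hx x0 wx fx]]]; split=> //.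
exact: localize_iso hx x0 wx erefl fx.
Qed.

(** The Euler operator acts on the degree [j] part of the localization of [M]
    by [w + j - i] if [M] has weight [w] in degree [i]; comparing with [N_alpha]
    gives [alpha = w - i]. So [alpha] is a weight of [M] unless exactly one of [alpha]
    and [w] is in [Gamma].  For [alpha = 0], the weights of [M] must be in
    [Gamma], since otherwise the localization vanishes. *)
Lemma is_Malpha_vector alpha M : index alpha -> is_Malpha alpha M ->
  exists x : M, [/\ gm_hom 0 x, x <> 0 & weight e alpha x].
Proof.
move=> ia [sM /gr_iso_sym[f [bf hf]]].
pose a : DT := eT - alpha *: (1 : DT).
pose n1 : Nmod alpha := cyclic_pi a 1.
have hn1 : gm_hom 0 n1 by exists 1; first exact: homT1.
have n10 : n1 <> 0.
  move=> /cyclic_pi_eq0[c /(congr1 (@sa_val _ _)) h].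
  by apply: (one_notin_left_ideal (a := alpha) (valP c)); exact: h.
have wn1 : weight eT alpha n1.
  apply/eqP; rewrite -subr_eq0; apply/eqP.
  by rewrite /kscale -scalerBl; exact: cyclic_ann.
have fn0 : f n1 <> 0.
  by move=> h; apply: n10; apply: (bij_inj bf); rewrite h linear0.
have wfn : weight eT alpha (f n1) by rewrite /weight -[LHS]linearZ wn1 [LHS]linearZ.
have hfn := (hf 0 n1).1 hn1.
have [i [x [w [hx x0 wx]]]] := simple_eigenvector eE (@DiffA_graded R Gamma) sM.
have aw : alpha = w - i%:~R.
  have := weight_uniq fn0 wfn (localize_weight sM hx x0 wx hfn).
  by rewrite sub0r rmorphN.
have wa : w = alpha + i%:~R by rewrite aw subrK.
have [|y [hy y0]] := simple_next_weight (d := - i) sM hx x0 wx.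
  rewrite rmorphN -aw; case: (ia) => [Ja|a0].
    have nz := Jstar_nonint Ja.
    split=> h; exfalso; [move: h|move: h]; apply: nonint_not_semigroup => // z wz.
    by apply: (nz (z - i)); rewrite aw wz rmorphB.
  split=> _; first by rewrite a0; exact: semigroup_weight0.
  apply: contrapT => nw; apply: fn0.
  by apply: (localize_zero sM hx x0 wx (z := i) _ nw hfn); rewrite wa a0 add0r.
rewrite subrr in hy; exists y; split=> //.
have := simple_weight eE (@DiffA_graded _ _) sM hx x0 wx hy.
by rewrite sub0r rmorphN -aw.
Qed.

Lemma is_Malpha_uniq alpha M N : index alpha ->
  is_Malpha alpha M -> is_Malpha alpha N -> gr_iso M N.
Proof.
move=> ia hM hN; have [x [hx x0 wx]] := is_Malpha_vector ia hM.
have [y [hy y0 wy]] := is_Malpha_vector ia hN.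
by apply: (simple_iso_of_weight eE (@DiffA_graded _ _) _ _ hx x0 wx hy y0 wy); [case: hM|case: hN].
Qed.

(** The value [-1] comes from [E = \partial t - 1], which acts by [-1] on the class
    of [1] in [A_1 / A_1 t]. *)
Definition base_weight (i : option k) : k := if i is Some alpha then alpha else -1.

Lemma not_semigroup_weightN1 : ~ semigroup_weight Gamma (-1 : k).
Proof.
by move=> [n _] /eqP; rewrite eq_sym -subr_eq0 opprK natr1 pnatr_eq0.
Qed.

Lemma base_weight_uniq i j w : Mfam_index i -> Mfam_index j ->
  same_class Gamma (base_weight i) w -> same_class Gamma (base_weight j) w -> i = j.
Proof.
move=> hi hj [z [wz iw]] [z' [wz' jw]].
have {wz wz'} zz : base_weight j = base_weight i + (z - z')%:~R.
  by rewrite rmorphB /= addrA -wz wz' addrK.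
have {iw jw} sij : semigroup_weight Gamma (base_weight i) <-> semigroup_weight Gamma (base_weight j).
  by rewrite iw jw.
case: i hi zz sij => [a|] hi; case: j hj => [b|] hj //= zz sij.
- by have z0 := index_translate hi hj zz; rewrite z0 addr0 in zz; rewrite zz.
- case: not_semigroup_weightN1; apply/sij.
  case: hi => [Ja|->]; last exact: semigroup_weight0.
  case: (Jstar_nonint Ja (z := - 1 - (z - z'))).
  by rewrite [RHS]rmorphB rmorphN1 zz addrK.
- case: not_semigroup_weightN1; apply/sij.
  case: hj => [Ja|->]; last exact: semigroup_weight0.
  case: (Jstar_nonint Ja (z := - 1 + (z - z'))).
  by rewrite [RHS]rmorphD rmorphN1 zz.
Qed.

(** The fractional part of [Re w] selects the coset of [w] modulo the
    integers; an integral [w] is in the class of [0] or [-1] according to whether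
    it belongs to [Gamma]. *)
Lemma base_weight_exists w : exists i, Mfam_index i /\ same_class Gamma (base_weight i) w.
Proof.
pose z := Num.floor (complex.Re w); pose a := w - z%:~R.
have wa : w = a + z%:~R by rewrite subrK.
have Ra : 0 <= complex.Re a < 1.
  rewrite /a -rmorphN /= Re_add Re_int rmorphN /=.
  have := floor_le (complex.Re w); have := floorD1_gt (complex.Re w).
  by rewrite -/z rmorphD /=; lra.
have [a0|a0] := pselect (a = 0).
  have [sw|nsw] := pselect (semigroup_weight Gamma w).
    exists (Some 0); split; first by right.
    by exists z; split; [rewrite wa a0|split=> // _; exact: semigroup_weight0].
  exists None; split=> //; exists (z + 1); split.
    by rewrite wa a0 add0r rmorphD /= addrCA addNr addr0.
  by split=> [/not_semigroup_weightN1|/nsw].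
have Ja : Jstar a by [].
exists (Some a); split; first by left.
have nz := Jstar_nonint Ja.
exists z; split=> //; split=> h; exfalso; move: h; apply: nonint_not_semigroup => //.
by move=> z' wz'; apply: (nz (z' - z)); rewrite rmorphB /= -wz' wa addrK.
Qed.

End Classification.

Theorem theorem10 (R : realType) (Gamma : numerical_semigroup) :
  (* the modules M_alpha exist and are unique up to graded isomorphism *)
  (forall alpha : R[i], Jstar alpha \/ alpha = 0 ->
     (exists M : grMod (DiffA R Gamma), is_Malpha alpha M) /\
     (forall M N : grMod (DiffA R Gamma),
        is_Malpha alpha M -> is_Malpha alpha N ->
        gr_iso M N)) /\
  (* the classification, for any choice of the modules M_alpha *)
  (forall M : R[i] -> grMod (DiffA R Gamma),
     (forall alpha, Jstar alpha \/ alpha = 0 ->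
        is_Malpha alpha (M alpha)) ->
     [/\ forall i, Mfam_index i -> simple_graded (Mfam M i),
         forall X : grMod (DiffA R Gamma), simple_graded X ->
           exists! i : option R[i],
             Mfam_index i /\ exists n : int, gr_iso X (twist n (Mfam M i)),
         gr_iso (M 0) (Acurve R Gamma)
       & forall alpha, Jstar alpha ->
           gr_iso (M alpha) (DmodE Gamma alpha)]).
Proof.
split=> [alpha ia|M hM].
  split; first by exists (standard Gamma alpha); exact: standard_is_Malpha.
  by move=> M N; exact: is_Malpha_uniq.
have simple_fam i : Mfam_index i -> simple_graded (Mfam M i).
  by case: i => [a /hM[]|_] //=; exact: Minf_simple.
have weight_fam i : Mfam_index i -> has_weight (Mfam M i) (base_weight i).
  case: i => [a ia|_] /=; last exact: Minf_has_weight.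
  by have [x hx] := is_Malpha_vector ia (hM a ia); exists 0, x.
split=> //.
- move=> X sX; have [w hw] := simple_weight_exists sX.
  have [i [ii iw]] := base_weight_exists Gamma w; exists i; split.
    split=> //; apply: (simple_iso_twist sX (simple_fam i ii) hw).
    exact/(simple_has_weight _ (simple_fam i ii) (weight_fam i ii)).
  move=> j [ij [n Xj]]; apply: (base_weight_uniq ii ij iw).
  apply/(simple_has_weight _ (simple_fam j ij) (weight_fam j ij)).
  by apply/(twist_has_weight n); exact: gr_iso_has_weight Xj hw.
- have i0 : index (0 : R[i]) by right.
  have := standard_is_Malpha Gamma i0; rewrite /standard eqxx.
  by apply: is_Malpha_uniq => //; exact: hM.
- move=> alpha Ja; have ia : index alpha by left.
  have := standard_is_Malpha Gamma ia; rewrite /standard.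
  case: eqP => [a0|_]; first by case: Ja => _ [].
  by apply: is_Malpha_uniq => //; exact: hM.
Qed.
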